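(* Let $([0,1],T^{\pm})$ be a Lorenz system with critical point $q\in(0,1)$, such that $T^{-}(q)\neq 1$ and $T^{+}(q)\neq 0$. Let $\alpha:=\tau_q^-(q)$ and $\beta:=\tau_q^+(q)$. Then for each $a\in\mathbb{R}$ the following statements are equivalent. (i) $a\in(\exp(h(T)),2)$. (ii) The open interval $(\pi_a(\alpha),\pi_a(\beta))\cap(1-a^{-1},a^{-1})$ is non-empty, and $\alpha\prec\mu_{a,p}^{-}(p)\prec\mu_{a,p}^{+}(p)\prec\beta$ for all $p\in(\pi_a(\alpha),\pi_a(\beta))\cap(1-a^{-1},a^{-1})$. (iii) The open interval $(\pi_a(\alpha),\pi_a(\beta))\cap(1-a^{-1},a^{-1})$ is non-empty, and $\Omega_q^{-}\subset\Omega_{a,p}^{-}$ and $\Omega_q^{+}\subset\Omega_{a,p}^{+}$ for all $p\in(\pi_a(\alpha),\pi_a(\beta))\cap(1-a^{-1},a^{-1})$.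
   Context: Lorenz maps: let $q\in(0,1)$ and let $f_0:[0,q]\to[0,1]$, $f_1:[q,1]\to[0,1]$ be continuous strictly increasing functions with $f_0(0)=0$, $f_1(1)=1$ and either $1>f_0(q)>f_1(q)\ge 0$ or $1\ge f_0(q)>f_1(q)>0$, such that there is $s>1$ with $|f_i(x)-f_i(y)|\ge s|x-y|$ for $i\in\{0,1\}$ and all $x,y$ in the domain of $f_i$. The upper Lorenz map $T^+:[0,1]\to[0,1]$ with critical point $q$ equals $f_0$ on $[0,q)$ and $f_1$ on $[q,1]$; the lower Lorenz map $T^-$ equals $f_0$ on $[0,q]$ and $f_1$ on $(q,1]$. ''Lorenz system $([0,1],T^\pm)$'' means both $T^+$ and $T^-$, built from the same $f_0,f_1$. Itineraries: $\Omega=\{0,1\}^{\infty}$ is the set of infinite strings $\omega_0\omega_1\omega_2\cdots$ over $\{0,1\}$ with the lexicographic order $\prec,\preceq$. For $x\in[0,1]$, $\tau_q^+(x)=\omega_0\omega_1\cdots$ with $\omega_k=0$ if $(T^+)^k(x)<q$ and $\omega_k=1$ if $(T^+)^k(x)\ge q$; $\tau_q^-(x)=\sigma_0\sigma_1\cdots$ with $\sigma_k=0$ if $(T^-)^k(x)\le q$ and $\sigma_k=1$ if $(T^-)^k(x)>q$. The address spaces are $\Omega_q^\pm:=\tau_q^\pm([0,1])$. Entropy: $h(T^\pm):=\lim_{n\to\infty}\frac1n\ln|\Omega_{q,n}^\pm|$, where $\Omega_{q,n}^\pm$ is the set of length-$n$ prefixes of elements of $\Omega_q^\pm$. It is known that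 $h(T^+)=h(T^-)\le\ln 2$; the common value is denoted $h(T)$. Uniform Lorenz maps: $(a,p)$ is admissible if $a\in(1,2)$, $p\in(0,1)$ and $1-a^{-1}\le p\le a^{-1}$. For admissible $(a,p)$, $U_{a,p}^+(x)=ax$ for $0\le x<p$ and $ax+1-a$ for $p\le x\le1$; $U_{a,p}^-(x)=ax$ for $0\le x\le p$ and $ax+1-a$ for $p<x\le 1$. These are Lorenz maps with critical point $p$; their itinerary maps and address spaces are denoted $\mu_{a,p}^\pm$ and $\Omega_{a,p}^\pm=\mu_{a,p}^{\pm}([0,1])$. Coding map: for $a\in(1,2)$, $\pi_a:\Omega\to[0,1]$, $\pi_a(\omega_0\omega_1\cdots)=(1-a^{-1})\sum_{k\ge0}\omega_k a^{-k}$. Conventions: $\subset$ denotes proper inclusion. The objects $\pi_a,\mu_{a,p}^\pm,\Omega_{a,p}^\pm$ are defined only for $a\in(1,2)$, so statements involving them are understood to include the requirement $a\in(1,2)$. *)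

(* Defs.v *)
From HB Require Import structures.
From mathcomp Require Import all_boot all_order all_algebra.
From mathcomp Require Import all_classical all_reals all_analysis.

Set Implicit Arguments.
Unset Strict Implicit.
Unset Printing Implicit Defensive.

Import Order.TTheory GRing.Theory Num.Theory.
Import numFieldNormedType.Exports.

Local Open Scope classical_set_scope.
Local Open Scope ring_scope.

(* The symbols 0 and 1 are encoded as false and true. *)
Notation bitstream := (nat -> bool).

Definition lex_lt (u v : bitstream) : Prop :=
  exists n, [/\ (forall k, (k < n)%N -> u k = v k), u n = false & v n = true].

Definition expanding_on (R : realType) (A : interval R) (s : R) (f : R -> R) : Prop :=
  forall x y, x \in A -> y \in A -> s * `|x - y| <= `|f x - f y|.

(* The branches are total functions on R, but only the values of f0 on [0, q]
   and of f1 on [q, 1] are constrained and ever used below. *)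
Record is_lorenz (R : realType) (q : R) (f0 f1 : R -> R) : Prop := IsLorenz {
  lorenz_crit : 0 < q < 1;
  lorenz_range0 : forall x, x \in `[0, q] -> f0 x \in `[0, 1];
  lorenz_range1 : forall x, x \in `[q, 1] -> f1 x \in `[0, 1];
  lorenz_cont0 : {within `[0, q], continuous f0};
  lorenz_cont1 : {within `[q, 1], continuous f1};
  lorenz_incr0 : {in `[0, q] &, {homo f0 : x y / x < y}};
  lorenz_incr1 : {in `[q, 1] &, {homo f1 : x y / x < y}};
  lorenz_fix0 : f0 0 = 0;
  lorenz_fix1 : f1 1 = 1;
  lorenz_jump : [&& f0 q < 1, f1 q < f0 q & 0 <= f1 q] ||
                [&& f0 q <= 1, f1 q < f0 q & 0 < f1 q];
  lorenz_expand : exists2 s, 1 < s &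
    expanding_on `[0, q] s f0 /\ expanding_on `[q, 1] s f1 }.

Section Lorenz.
Context {R : realType}.
Implicit Types (q x a p : R) (f : R -> R).

Definition upper_map q f0 f1 x : R := if x < q then f0 x else f1 x.
Definition lower_map q f0 f1 x : R := if x <= q then f0 x else f1 x.

Definition upper_itinerary q f0 f1 x : bitstream :=
  fun k => q <= iter k (upper_map q f0 f1) x.
Definition lower_itinerary q f0 f1 x : bitstream :=
  fun k => q < iter k (lower_map q f0 f1) x.

Definition upper_address q f0 f1 : set bitstream :=
  upper_itinerary q f0 f1 @` `[0, 1].
Definition lower_address q f0 f1 : set bitstream :=
  lower_itinerary q f0 f1 @` `[0, 1].

Definition prefix_of n (w : bitstream) : n.-tuple bool := [tuple w i | i < n].

Definition prefixes n (A : set bitstream) : {set n.-tuple bool} :=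
  [set u | u \in prefix_of n @` A]%SET.

Definition entropy (A : set bitstream) : R :=
  limn (fun n => ln #|prefixes n A|%:R / n%:R).

(* The choice of the upper map is immaterial: see entropy_lower_upper. *)
Definition lorenz_entropy q f0 f1 : R := entropy (upper_address q f0 f1).

Definition unif0 a x : R := a * x.
Definition unif1 a x : R := a * x + 1 - a.

Definition unif_upper_itinerary a p := upper_itinerary p (unif0 a) (unif1 a).
Definition unif_lower_itinerary a p := lower_itinerary p (unif0 a) (unif1 a).
Definition unif_upper_address a p := upper_address p (unif0 a) (unif1 a).
Definition unif_lower_address a p := lower_address p (unif0 a) (unif1 a).

Definition coding a (w : bitstream) : R :=
  (1 - a^-1) * limn (series (fun k => (w k)%:R * a ^- k)).

Definition param_interval a (u v : bitstream) : set R :=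
  `]coding a u, coding a v[ `&` `](1 - a^-1), a^-1[.


Lemma within_itv_dist (u v x e : R) (f : R -> R) :
  {within `[u, v], continuous f} -> x \in `[u, v] -> 0 < e ->
  exists2 d, 0 < d & forall y, y \in `[u, v] -> `|x - y| < d -> `|f x - f y| < e.
Proof.
move=> /subspace_continuousP cf xuv e0.
have /cvgrPdist_lt /(_ _ e0) := cf x xuv.
move=> /nbhs_ballP[d /= d0 H]; exists d => // y yuv xy.
exact: H.
Qed.

Lemma lorenz_bounds q f0 f1 : is_lorenz q f0 f1 ->
  [/\ 0 < q, q < 1, f0 q <= 1, 0 <= f1 q & f1 q < f0 q].
Proof.
move=> h; have /andP[q0 q1] := lorenz_crit h.
by have /orP[/and3P[A B C]|/and3P[A B C]] := lorenz_jump h; split => //; exact: ltW.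
Qed.

Lemma upper_itinerary_right q f0 f1 n x : is_lorenz q f0 f1 -> 0 <= x < 1 ->
  exists2 d, 0 < d & forall y, x < y < x + d -> y < 1 /\
    forall k, (k < n)%N -> upper_itinerary q f0 f1 x k = lower_itinerary q f0 f1 y k.
Proof.
move=> h; have [q0 q1 f0q f1q _] := lorenz_bounds h.
elim: n x => [|n IH] x /andP[x0 x1].
  exists (1 - x) => [|y]; first by rewrite subr_gt0.
  by rewrite [x + _]addrC subrK => /andP[].
have itS k y : upper_itinerary q f0 f1 y k.+1 =
    upper_itinerary q f0 f1 (upper_map q f0 f1 y) k.
  by rewrite /upper_itinerary iterSr.
have itS' k y : lower_itinerary q f0 f1 y k.+1 =
    lower_itinerary q f0 f1 (lower_map q f0 f1 y) k.
  by rewrite /lower_itinerary iterSr.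
have step (u v : R) f : {within `[u, v], continuous f} ->
    {in `[u, v] &, {homo f : x y / x < y}} -> u <= x < v -> v <= 1 ->
    0 <= f x < 1 -> upper_map q f0 f1 x = f x ->
    (forall y, x < y < v -> (q <= x) = (q < y) /\ lower_map q f0 f1 y = f y) ->
    exists2 d, 0 < d & forall y, x < y < x + d -> y < 1 /\
    forall k, (k < n.+1)%N -> upper_itinerary q f0 f1 x k = lower_itinerary q f0 f1 y k.
  move=> cf hf /andP[ux xv] v1 fx01 Ux Ly.
  have [d d0 Hd] := IH _ fx01.
  have xuv : x \in `[u, v] by rewrite in_itv /= ux ltW.
  have [e e0 He] := within_itv_dist cf xuv d0.
  exists (Num.min e (v - x)); first by rewrite lt_min e0 subr_gt0.
  move=> y /andP[xy]; rewrite -ltrBlDl lt_min => /andP[ye].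
  rewrite ltrBlDl addrC subrK => yv.
  have yuv : y \in `[u, v] by rewrite in_itv /= (ltW yv) (le_trans ux (ltW xy)).
  split; first exact: lt_le_trans v1.
  have [qq ly] := Ly y (introT andP (conj xy yv)).
  case=> [_|k]; first by rewrite /upper_itinerary /lower_itinerary.
  rewrite ltnS => kn; rewrite itS itS' Ux ly; apply: (Hd _ _).2 => //.
  have fxy := hf _ _ xuv yuv xy; rewrite fxy /=.
  have := He y yuv; rewrite distrC gtr0_norm ?subr_gt0// => /(_ ye).
  by rewrite distrC gtr0_norm ?subr_gt0// ltrBlDl.
have [xq|qx] := ltP x q.
- apply: (step 0 q f0) => //.
  + exact: lorenz_cont0 h.
  + exact: lorenz_incr0 h.
  + by rewrite x0.
  + exact: ltW.
  + have xi : x \in `[0, q] by rewrite in_itv /= x0 ltW.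
    have := lorenz_range0 h xi; rewrite in_itv /= => /andP[-> _] /=.
    apply: lt_le_trans f0q; apply: (lorenz_incr0 h) => //.
    by rewrite in_itv /= lexx ltW.
  + by rewrite /upper_map xq.
  + move=> y /andP[xy yq]; rewrite /lower_map (ltW yq) leNgt xq; split => //.
    by rewrite ltNge (ltW yq).
- apply: (step q 1 f1) => //.
  + exact: lorenz_cont1 h.
  + exact: lorenz_incr1 h.
  + by rewrite qx.
  + have xi : x \in `[q, 1] by rewrite in_itv /= qx ltW.
    have := lorenz_range1 h xi; rewrite in_itv /= => /andP[-> _] /=.
    rewrite -[X in _ < X](lorenz_fix1 h); apply: (lorenz_incr1 h) => //.
    by rewrite in_itv /= lexx ltW.
  + by rewrite /upper_map ltNge qx.
  + move=> y /andP[xy y1]; have qy := le_lt_trans qx xy.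
    by rewrite /lower_map (leNgt y) qy qx.
Qed.

Lemma lower_itinerary_left q f0 f1 n x : is_lorenz q f0 f1 -> 0 < x <= 1 ->
  exists2 d, 0 < d & forall y, x - d < y < x -> 0 < y /\
    forall k, (k < n)%N -> lower_itinerary q f0 f1 x k = upper_itinerary q f0 f1 y k.
Proof.
move=> h; have [q0 q1 f0q f1q _] := lorenz_bounds h.
elim: n x => [|n IH] x /andP[x0 x1].
  exists x => // y; by rewrite subrr => /andP[].
have itS k y : upper_itinerary q f0 f1 y k.+1 =
    upper_itinerary q f0 f1 (upper_map q f0 f1 y) k.
  by rewrite /upper_itinerary iterSr.
have itS' k y : lower_itinerary q f0 f1 y k.+1 =
    lower_itinerary q f0 f1 (lower_map q f0 f1 y) k.
  by rewrite /lower_itinerary iterSr.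
have step (u v : R) f : {within `[u, v], continuous f} ->
    {in `[u, v] &, {homo f : x y / x < y}} -> u < x <= v -> 0 <= u ->
    0 < f x <= 1 -> lower_map q f0 f1 x = f x ->
    (forall y, u < y < x -> (q < x) = (q <= y) /\ upper_map q f0 f1 y = f y) ->
    exists2 d, 0 < d & forall y, x - d < y < x -> 0 < y /\
    forall k, (k < n.+1)%N -> lower_itinerary q f0 f1 x k = upper_itinerary q f0 f1 y k.
  move=> cf hf /andP[ux xv] u0 fx01 Ux Ly.
  have [d d0 Hd] := IH _ fx01.
  have xuv : x \in `[u, v] by rewrite in_itv /= xv ltW.
  have [e e0 He] := within_itv_dist cf xuv d0.
  exists (Num.min e (x - u)); first by rewrite lt_min e0 subr_gt0.
  move=> y /andP[]; rewrite ltrBlDr -ltrBlDl lt_min => /andP[ye].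
  rewrite ltrD2l ltrN2 => uy yx.
  have yuv : y \in `[u, v] by rewrite in_itv /= (ltW uy) (le_trans (ltW yx) xv).
  split; first exact: le_lt_trans uy.
  have [qq ly] := Ly y (introT andP (conj uy yx)).
  case=> [_|k]; first by rewrite /upper_itinerary /lower_itinerary.
  rewrite ltnS => kn; rewrite itS itS' Ux ly; apply: (Hd _ _).2 => //.
  have fxy := hf _ _ yuv xuv yx; rewrite fxy andbT.
  have := He y yuv; rewrite gtr0_norm ?subr_gt0// => /(_ ye).
  by rewrite gtr0_norm ?subr_gt0// ltrBlDl -ltrBlDr.
have [xq|qx] := leP x q.
- apply: (step 0 q f0) => //.
  + exact: lorenz_cont0 h.
  + exact: lorenz_incr0 h.
  + by rewrite x0.
  + have xi : x \in `[0, q] by rewrite in_itv /= xq ltW.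
    have := lorenz_range0 h xi; rewrite in_itv /= => /andP[_ ->].
    rewrite andbT -[X in X < _](lorenz_fix0 h); apply: (lorenz_incr0 h) => //.
    by rewrite in_itv /= lexx ltW.
  + by rewrite /lower_map xq.
  + move=> y /andP[_ yx]; have yq := lt_le_trans yx xq.
    by rewrite /upper_map yq ltNge xq leNgt yq.
- apply: (step q 1 f1) => //.
  + exact: lorenz_cont1 h.
  + exact: lorenz_incr1 h.
  + by rewrite qx.
  + exact: ltW.
  + have xi : x \in `[q, 1] by rewrite in_itv /= x1 ltW.
    have := lorenz_range1 h xi; rewrite in_itv /= => /andP[_ ->].
    rewrite andbT; apply: le_lt_trans f1q _; apply: (lorenz_incr1 h) => //.
    by rewrite in_itv /= lexx ltW.
  + by rewrite /lower_map leNgt qx.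
  + by move=> y /andP[qy _]; rewrite /upper_map (ltNge y) (ltW qy) qx.
Qed.

Lemma lorenz_itinerary_ends q f0 f1 : is_lorenz q f0 f1 ->
  upper_itinerary q f0 f1 1 = lower_itinerary q f0 f1 1 /\
  lower_itinerary q f0 f1 0 = upper_itinerary q f0 f1 0.
Proof.
move=> h; have [q0 q1 _ _ _] := lorenz_bounds h; split.
- have U k : iter k (upper_map q f0 f1) 1 = 1.
    by elim: k => //= k ->; rewrite /upper_map ltNge (ltW q1) /= (lorenz_fix1 h).
  have L k : iter k (lower_map q f0 f1) 1 = 1.
    by elim: k => //= k ->; rewrite /lower_map leNgt q1 /= (lorenz_fix1 h).
  by apply: funext => k; rewrite /upper_itinerary /lower_itinerary U L q1 ltW.
- have U k : iter k (upper_map q f0 f1) 0 = 0.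
    by elim: k => //= k ->; rewrite /upper_map q0 (lorenz_fix0 h).
  have L k : iter k (lower_map q f0 f1) 0 = 0.
    by elim: k => //= k ->; rewrite /lower_map (ltW q0) (lorenz_fix0 h).
  apply: funext => k; rewrite /upper_itinerary /lower_itinerary U L.
  by rewrite ltNge (ltW q0) leNgt q0.
Qed.

Lemma prefixes_lower_upper q f0 f1 n : is_lorenz q f0 f1 ->
  prefixes n (lower_address q f0 f1) = prefixes n (upper_address q f0 f1).
Proof.
move=> h; have [E1 E0] := lorenz_itinerary_ends h.
apply/setP => u; rewrite !inE; apply/idP/idP => /set_mem.
- move=> [w [x]]; rewrite /= in_itv /= => /andP[x0 x1] <- <-; apply: mem_set.
  have [->|xn0] := eqVneq x 0.
    exists (upper_itinerary q f0 f1 0); last by rewrite E0.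
    by exists 0 => //=; rewrite in_itv /= lexx ler01.
  have xp : 0 < x by rewrite lt_neqAle eq_sym xn0.
  have [|d d0 H] := @lower_itinerary_left q f0 f1 n x h; first by rewrite xp.
  have xd : x - d < x - d / 2 < x.
    by rewrite ltrD2l ltrN2 ltrBlDr ltrDl divr_gt0// andbT ltr_pdivrMr// mulr2n mulrDr mulr1 ltrDl.
  have [y0 Hy] := H _ xd; exists (upper_itinerary q f0 f1 (x - d / 2)).
    exists (x - d / 2) => //=; rewrite in_itv /= (ltW y0) /=.
    by apply: le_trans x1; apply: ltW; case/andP: xd.
  by apply: eq_from_tnth => i; rewrite !tnth_mktuple Hy.
- move=> [w [x]]; rewrite /= in_itv /= => /andP[x0 x1] <- <-; apply: mem_set.
  have [->|xn1] := eqVneq x 1.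
    exists (lower_itinerary q f0 f1 1); last by rewrite E1.
    by exists 1 => //=; rewrite in_itv /= lexx ler01.
  have xp : x < 1 by rewrite lt_neqAle xn1.
  have [|d d0 H] := @upper_itinerary_right q f0 f1 n x h; first by rewrite x0.
  have xd : x < x + d / 2 < x + d.
    by rewrite ltrD2l ltrDl divr_gt0//= ltr_pdivrMr// mulr2n mulrDr mulr1 ltrDl.
  have [y1 Hy] := H _ xd; exists (lower_itinerary q f0 f1 (x + d / 2)).
    exists (x + d / 2) => //=; rewrite in_itv /= (ltW y1) andbT.
    by apply: le_trans x0 _; apply: ltW; case/andP: xd.
  by apply: eq_from_tnth => i; rewrite !tnth_mktuple Hy.
Qed.

Lemma entropy_lower_upper q f0 f1 : is_lorenz q f0 f1 ->
  entropy (lower_address q f0 f1) = entropy (upper_address q f0 f1).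
Proof.
move=> h; rewrite /entropy; congr (limn _); apply: funext => n.
by rewrite prefixes_lower_upper.
Qed.

End Lorenz.

(* Main.v *)
(* Let rank n w be the number of length-n prefixes of itineraries that lie
   strictly to the left of the prefix of w.  If w is an itinerary, then
   rank n.+1 w = rank n (shift w) + w_0 E_n with E_n independent of w, so the
   series W(w) = \sum_n rank n w * a ^- n satisfies, as soon as it converges,
   W(w) = a^-1 W(shift w) + w_0 K, and is therefore a positive multiple of the
   coding map.  It converges for a > exp h, and W is increasing with a jump at
   the critical point: the coding map is then increasing on itineraries and
   coding alpha < coding beta, which gives (ii) and (iii).
   Conversely, (ii) and (iii) each make some p separate the codings of the
   itineraries starting with 0 from those starting with 1, so the coding map is
   nondecreasing on itineraries, with a gap of length at least
   a ^- k (coding beta - coding alpha) between any two words that first differ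
   at time k.  These gaps are disjoint in [0, 1], so the number c_k of words of
   length k satisfies \sum_k a ^- k (c_(k+1) - c_k) < oo, whereas c_k >= exp(k h)
   by subadditivity: hence exp h < a. *)
Require Import Defs.
From mathcomp Require Import all_boot all_order all_algebra.
From mathcomp Require Import all_classical all_reals all_analysis.
From mathcomp Require Import ring lra zify.

Import Order.TTheory GRing.Theory Num.Theory.
Import numFieldNormedType.Exports.

Local Open Scope classical_set_scope.
Local Open Scope ring_scope.

Set Implicit Arguments.
Unset Strict Implicit.
Unset Printing Implicit Defensive.

(** * Binary words, their prefix codes and the lexicographic order *)

Definition shift (w : bitstream) : bitstream := fun k => w k.+1.

(* The first n symbols of w, read as an n-bit binary number: the lexicographic
   order on prefixes of a given length becomes the order of natural numbers. *)
Fixpoint code (n : nat) (w : bitstream) : nat :=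
  if n is m.+1 then (w 0%N * 2 ^ m + code m (shift w))%N else 0%N.

(** Comparing all prefixes at once allows proofs by induction on the length, with no search for a
    first difference, and transfers directly to counts of prefixes. *)
Definition lex_le (u v : bitstream) := forall n, (code n u <= code n v)%N.

Lemma code_lt n w : (code n w < 2 ^ n)%N.
Proof.
elim: n w => [//|n IH] w /=; have := IH (shift w).
by rewrite expnS; case: (w 0%N) => /= ?; lia.
Qed.

Lemma code_prefix n u v : code n u = code n v -> forall k, (k < n)%N -> u k = v k.
Proof.
elim: n u v => [//|n IH] u v /= E.
have [E0 E1] : u 0%N = v 0%N /\ code n (shift u) = code n (shift v).
  have := code_lt n (shift u); have := code_lt n (shift v).
  by move: E; case: (u 0%N); case: (v 0%N) => /= *; split => //; lia.
by case=> [//|k]; rewrite ltnS; apply: (IH _ _ E1).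
Qed.

Lemma eq_code n u v : (forall k, (k < n)%N -> u k = v k) -> code n u = code n v.
Proof.
elim: n u v => [//|n IH] u v E /=; rewrite E//; congr (_ + _)%N.
by apply: IH => k kn; apply: E.
Qed.

Lemma iter_shift m w k : iter m shift w k = w (m + k)%N.
Proof. by elim: m k => // m IH k; rewrite iterS /shift IH addnS. Qed.

Lemma code_cat m n w :
  code (m + n) w = (code m w * 2 ^ n + code n (iter m shift w))%N.
Proof.
elim: m w => [//|m IH] w; by rewrite addSn iterSr /= IH expnD mulnDl mulnA addnA.
Qed.

Lemma lex_le_refl u : lex_le u u.
Proof. by []. Qed.

Lemma lex_le_trans v u w : lex_le u v -> lex_le v w -> lex_le u w.
Proof. by move=> uv vw n; apply: leq_trans (uv n) (vw n). Qed.

Lemma lex_le_shift u v : lex_le u v -> u 0%N = v 0%N -> lex_le (shift u) (shift v).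
Proof. by move=> uv E n; have := uv n.+1; rewrite /= E leq_add2l. Qed.

Lemma lex_le_head u v : lex_le u v -> u 0%N -> v 0%N.
Proof. by move=> /(_ 1%N) /=; case: (u 0%N); case: (v 0%N). Qed.

Lemma lex_ltW u v : lex_lt u v -> lex_le u v.
Proof.
move=> [n [E un vn]] m.
elim: n m u v E un vn => [|n IH] [//|m] u v E un vn /=.
  by rewrite un vn /=; have := code_lt m (shift u); lia.
rewrite E// leq_add2l; apply: IH => // k kn.
exact: E.
Qed.

Lemma lex_le_neq u v : lex_le u v -> u <> v -> lex_lt u v.
Proof.
move=> uv neq; have ex : exists n, u n != v n.
  apply: contrapT => H; apply: neq; apply: funext => n.
  by apply: contrapT => /eqP Hn; apply: H; exists n.
have [n Hn Hmin] := ex_minnP ex; exists n.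
have E k : (k < n)%N -> u k = v k.
  by move=> kn; apply/eqP; apply: contraLR kn => /Hmin; rewrite -leqNgt.
(* As [u] and [v] agree below [n], comparing codes of length [n.+1] compares the single symbols at
   [n]. *)
have := uv n.+1; rewrite -addn1 !code_cat (eq_code E) leq_add2l /= !iter_shift !addn0.
by move: Hn; case: (u n); case: (v n).
Qed.

Lemma code_ones n : (code n (fun=> true)).+1 = (2 ^ n)%N.
Proof. by elim: n => //= n IH; rewrite -addnS IH mul1n addnn -mul2n expnS. Qed.

Lemma code_zeros n : code n (fun=> false) = 0%N.
Proof. by elim: n => //= n IH; rewrite IH. Qed.

(** * Unboundedness of geometric growth *)

Lemma bernoulli_ge {R : realDomainType} (x : R) n : 0 <= x -> 1 + x *+ n <= (1 + x) ^+ n.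
Proof.
move=> x0; elim: n => [|n IH]; first by rewrite addr0.
rewrite exprS; apply: le_trans (_ : (1 + x) * (1 + x *+ n) <= _).
  by rewrite mulrDl mul1r mulrDr mulr1 mulrS; have := mulr_ge0 x0 (mulrn_wge0 n x0); lra.
by rewrite ler_wpM2l// addr_ge0.
Qed.

Lemma expr_unbounded {R : archiRealFieldType} (s M : R) : 1 < s -> exists n, M < s ^+ n.
Proof.
move=> s1; have s0 : 0 < s - 1 by rewrite subr_gt0.
exists (Num.bound (M / (s - 1))).
have := @bernoulli_ge _ (s - 1) (Num.bound (M / (s - 1))) (ltW s0).
rewrite [1 + (s - 1)]addrC subrK; apply: lt_le_trans.
have := ler_norm (M / (s - 1)) ; have := archi_boundP (normr_ge0 (M / (s - 1))).
have -> : Num.bound `|M / (s - 1)| = Num.bound (M / (s - 1)).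
  by rewrite /Num.bound normr_id.
move=> A B; have := le_lt_trans B A.
by rewrite ltr_pdivrMr// mulr_natl; lra.
Qed.

(** Here [u] stands for the distance of an orbit to the fixed point of a branch: an expanding branch
    cannot hold the orbit forever. *)
Lemma geometric_escape {R : archiRealFieldType} (u : nat -> R) (s : R) : 1 < s -> 0 < u 0%N ->
  (forall k, u k <= 1 /\ s * u k <= u k.+1) -> False.
Proof.
move=> s1 u0 H; have [n] := expr_unbounded (u 0%N)^-1 s1.
rewrite -[X in X < _]div1r ltr_pdivrMr// ltNge => /negP; apply.
apply: le_trans (H n).1; elim: n => [|n IH]; first by rewrite mul1r.
by apply: le_trans (H n).2; rewrite exprS -mulrA ler_wpM2l// ltW// (lt_trans _ s1).
Qed.

(** * Monotonicity of itineraries and extremality of the critical ones *)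

Section LorenzWords.
Context {R : realType}.
Variables (q : R) (f0 f1 : R -> R).
Hypothesis hT : is_lorenz q f0 f1.

Local Notation U := (upper_map q f0 f1).
Local Notation L := (lower_map q f0 f1).
Local Notation up := (upper_itinerary q f0 f1).
Local Notation lo := (lower_itinerary q f0 f1).

Lemma shift_upper x : shift (up x) = up (U x).
Proof. by apply: funext => k; rewrite /shift /upper_itinerary iterSr. Qed.

Lemma shift_lower x : shift (lo x) = lo (L x).
Proof. by apply: funext => k; rewrite /shift /lower_itinerary iterSr. Qed.

Lemma branch0_incr x y : 0 <= x -> x < y -> y <= q -> f0 x < f0 y.
Proof.
move=> x0 xy yq; apply: (lorenz_incr0 hT) => //; rewrite in_itv /=.
  by rewrite x0 (le_trans (ltW xy)).
by rewrite yq (le_trans x0 (ltW xy)).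
Qed.

Lemma branch1_incr x y : q <= x -> x < y -> y <= 1 -> f1 x < f1 y.
Proof.
move=> x0 xy yq; apply: (lorenz_incr1 hT) => //; rewrite in_itv /=.
  by rewrite x0 (le_trans (ltW xy)).
by rewrite yq (le_trans x0 (ltW xy)).
Qed.

Lemma branch0_range x : 0 <= x <= q -> 0 <= f0 x <= 1.
Proof. by move=> xq; have := @lorenz_range0 _ _ _ _ hT x; rewrite !in_itv; apply. Qed.

Lemma branch1_range x : q <= x <= 1 -> 0 <= f1 x <= 1.
Proof. by move=> xq; have := @lorenz_range1 _ _ _ _ hT x; rewrite !in_itv; apply. Qed.

Lemma upper_map_range x : 0 <= x <= 1 -> 0 <= U x <= 1.
Proof.
move=> /andP[x0 x1]; rewrite /upper_map; have [xq|xq] := ltP x q.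
  by apply: branch0_range; rewrite x0 ltW.
by apply: branch1_range; rewrite x1 xq.
Qed.

Lemma lower_map_range x : 0 <= x <= 1 -> 0 <= L x <= 1.
Proof.
move=> /andP[x0 x1]; rewrite /lower_map; have [xq|xq] := leP x q.
  by apply: branch0_range; rewrite x0.
by apply: branch1_range; rewrite x1 ltW.
Qed.

Lemma branch0_onto y : 0 <= y <= f0 q -> exists2 x, 0 <= x <= q & f0 x = y.
Proof.
have [q0 _ _ _ _] := lorenz_bounds hT.
move=> yf; have [|x] := @IVT R f0 0 q y (ltW q0) (lorenz_cont0 hT).
  rewrite (lorenz_fix0 hT) ge_min le_max; case/andP: yf => -> ->; by rewrite orbT.
by rewrite in_itv /=; exists x.
Qed.

Lemma branch1_onto y : f1 q <= y <= 1 -> exists2 x, q <= x <= 1 & f1 x = y.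
Proof.
have [_ q1 _ _ _] := lorenz_bounds hT.
move=> yf; have [|x] := @IVT R f1 q 1 y (ltW q1) (lorenz_cont1 hT).
  rewrite (lorenz_fix1 hT) ge_min le_max; case/andP: yf => -> ->; by rewrite orbT.
by rewrite in_itv /=; exists x.
Qed.

(** The two orbits of [x] coincide until they hit [q], where the lower itinerary reads 0 and the
    upper one reads 1. *)
Lemma lex_le_lower_upper x : 0 <= x <= 1 -> lex_le (lo x) (up x).
Proof.
move=> xI n; elim: n x xI => [//|n IH] x xI /=.
rewrite shift_lower shift_upper /upper_itinerary /lower_itinerary /=.
have [xq|xq|<-] := ltgtP q x.
- rewrite /lower_map leNgt xq /= /upper_map ltNge (ltW xq) /= leq_add2l IH//.
  by apply: branch1_range; case/andP: xI => _ ->; rewrite ltW.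
- rewrite /lower_map (ltW xq) /upper_map xq IH//.
  by apply: branch0_range; case/andP: xI => -> _; rewrite ltW.
- by rewrite mul0n mul1n; apply: leq_trans (ltnW (code_lt _ _)) (leq_addr _ _).
Qed.

(** Strictly increasing branches preserve [x < y] while both points use the same branch, and the
    first difference is 0 against 1. Strictness matters: [q <= x] gives [q < y], so the lower map
    also follows [f1]. *)
Lemma lex_le_upper_lower x y : 0 <= x -> x < y -> y <= 1 -> lex_le (up x) (lo y).
Proof.
move=> x0 xy y1 n; elim: n x y x0 xy y1 => [//|n IH] x y x0 xy y1 /=.
rewrite shift_lower shift_upper {1}/upper_itinerary {1}/lower_itinerary /=.
have [qx|xq] := leP q x.
  have qy := le_lt_trans qx xy; rewrite qy leq_add2l.
  rewrite /lower_map leNgt qy /= /upper_map ltNge qx /=; apply: IH.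
  - by have /andP[] : 0 <= f1 x <= 1 by apply: branch1_range; rewrite ?qx ?(le_trans (ltW xy)).
  - exact: branch1_incr.
  - by have /andP[] : 0 <= f1 y <= 1 by apply: branch1_range; rewrite ?y1 ?ltW.
have [qy|yq] := ltP q y; first by rewrite mul0n mul1n; apply: leq_trans (ltnW (code_lt _ _)) (leq_addr _ _).
rewrite /lower_map yq /upper_map xq /= leq_add2l; apply: IH.
- by have /andP[] : 0 <= f0 x <= 1 by apply: branch0_range; rewrite ?x0 ?ltW.
- exact: branch0_incr.
- by have /andP[] : 0 <= f0 y <= 1 by apply: branch0_range; rewrite ?yq ?andbT// (le_trans x0 (ltW _)).
Qed.

Lemma lex_le_upper x y : 0 <= x -> x <= y -> y <= 1 -> lex_le (up x) (up y).
Proof.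
move=> x0; rewrite le_eqVlt => /predU1P[<-|xy] y1; first exact: lex_le_refl.
apply: lex_le_trans (lex_le_upper_lower x0 xy y1) _.
by apply: lex_le_lower_upper; rewrite y1 (le_trans x0 (ltW _)).
Qed.

Lemma lex_le_lower x y : 0 <= x -> x <= y -> y <= 1 -> lex_le (lo x) (lo y).
Proof.
move=> x0; rewrite le_eqVlt => /predU1P[<-|xy] y1; first exact: lex_le_refl.
apply: lex_le_trans (lex_le_upper_lower x0 xy y1).
by apply: lex_le_lower_upper; rewrite x0 (le_trans (ltW xy)).
Qed.

(** Treating the two itineraries of a point together lets one argument serve both address spaces. *)
Definition itinerary_of (x : R) (w : bitstream) : Prop := w = up x \/ w = lo x.

Definition realized (w : bitstream) : Prop :=
  exists2 x, 0 <= x <= 1 & itinerary_of x w.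

Lemma itinerary_le_upper x w : 0 <= x <= 1 -> itinerary_of x w -> lex_le w (up x).
Proof. by move=> xI [->|->]; [exact: lex_le_refl|exact: lex_le_lower_upper]. Qed.

Lemma itinerary_shift0 x w : 0 <= x <= 1 -> itinerary_of x w -> w 0%N = false ->
  x <= q /\ itinerary_of (f0 x) (shift w).
Proof.
move=> xI [->|->]; rewrite /upper_itinerary /lower_itinerary /=.
  move/negbT; rewrite -ltNge => xq; split; first exact: ltW.
  by left; rewrite shift_upper /upper_map xq.
move/negbT; rewrite -leNgt => xq; split => //.
by right; rewrite shift_lower /lower_map xq.
Qed.

Lemma itinerary_shift1 x w : 0 <= x <= 1 -> itinerary_of x w -> w 0%N ->
  q <= x /\ itinerary_of (f1 x) (shift w).
Proof.
move=> xI [->|->]; rewrite /upper_itinerary /lower_itinerary /=.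
  move=> xq; split=> //.
  by left; rewrite shift_upper /upper_map ltNge xq.
move=> xq; split; first exact: ltW.
by right; rewrite shift_lower /lower_map leNgt xq.
Qed.

Lemma realized_upper x : 0 <= x <= 1 -> realized (up x).
Proof. by exists x => //; left. Qed.

Lemma realized_lower x : 0 <= x <= 1 -> realized (lo x).
Proof. by exists x => //; right. Qed.

Lemma realized_shift w : realized w -> realized (shift w).
Proof.
move=> [x xI [->|->]]; [rewrite shift_upper|rewrite shift_lower].
  exact/realized_upper/upper_map_range.
exact/realized_lower/lower_map_range.
Qed.

Lemma crit_range : 0 <= q <= 1.
Proof. by case: (lorenz_bounds hT) => q0 q1 _ _ _; rewrite !ltW. Qed.

(** A word starting with 0 comes from a point of [[0, q]], and from [[0, q)] if it is an upper
    itinerary, so monotonicity applies. With the mirror image [realized_ge_beta], no realized word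
    lies strictly between the critical itineraries. *)
Lemma realized_le_alpha w : realized w -> w 0%N = false -> lex_le w (lo q).
Proof.
have /andP[q0 q1] := crit_range.
move=> [x /andP[x0 x1] [->|->]]; rewrite /upper_itinerary /lower_itinerary /= => /negbT.
  by rewrite -ltNge => xq; apply: lex_le_upper_lower.
by rewrite -leNgt => xq; apply: lex_le_lower.
Qed.

Lemma realized_ge_beta w : realized w -> w 0%N -> lex_le (up q) w.
Proof.
have /andP[q0 q1] := crit_range.
move=> [x /andP[x0 x1] [->|->]]; rewrite /upper_itinerary /lower_itinerary /= => xq.
  exact: lex_le_upper.
exact: lex_le_upper_lower.
Qed.

Lemma shift_beta : shift (up q) = up (f1 q).
Proof. by rewrite shift_upper /upper_map ltxx. Qed.

Lemma shift_alpha : shift (lo q) = lo (f0 q).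
Proof. by rewrite shift_lower /lower_map lexx. Qed.

Lemma upper_one : up 1 = fun=> true.
Proof.
apply: funext => k; rewrite /upper_itinerary.
have /andP[_ q1] := crit_range; suff -> : iter k U 1 = 1 by [].
by elim: k => //= k ->; rewrite /upper_map ltNge q1 (lorenz_fix1 hT).
Qed.

Lemma upper_zero : up 0 = fun=> false.
Proof.
apply: funext => k; rewrite /upper_itinerary.
have [q0 _ _ _ _] := lorenz_bounds hT; suff -> : iter k U 0 = 0 by rewrite leNgt q0.
by elim: k => //= k ->; rewrite /upper_map q0 (lorenz_fix0 hT).
Qed.


(** An orbit confined to [[0, q)] would move away from the fixed point 0 by a factor [s > 1] at each
    step. The symbol 1 found here later puts the coding of [up q] above [1 - a^-1]. *)
Lemma beta_shift_has_one : 0 < f1 q -> exists k, shift (up q) k.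
Proof.
move=> f1q; rewrite shift_beta; apply: contrapT => H.
have [s s1 [Hs _]] := lorenz_expand hT.
apply: (@geometric_escape R (fun k => iter k U (f1 q)) s) => // k.
have iterI : 0 <= iter k U (f1 q) <= 1.
  elim: k => [|k IH]; last exact: upper_map_range.
  by rewrite ltW//=; have [_ _ a b c] := lorenz_bounds hT; rewrite (le_trans (ltW c)).
have kq : iter k U (f1 q) < q.
  by rewrite ltNge; apply/negP => qk; apply: H; exists k.
move: kq iterI; rewrite [iter k.+1 _ _]/=; move: (iter k U (f1 q)) => y yq /andP[y0 ->]; split => //.
rewrite /upper_map yq.
have /andP[q0 _] := crit_range.
have := Hs y 0; rewrite !in_itv /= lexx y0 (ltW yq) q0 => /(_ isT isT).
by rewrite (lorenz_fix0 hT) !subr0 !ger0_norm//; have /andP[] : 0 <= f0 y <= 1 by apply: branch0_range; rewrite ?y0 ?ltW.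
Qed.

(** Mirror image at the fixed point 1; it later puts the coding of [lo q] below [a^-1]. *)
Lemma alpha_shift_has_zero : f0 q < 1 -> exists k, shift (lo q) k = false.
Proof.
move=> f0q; rewrite shift_alpha; apply: contrapT => H.
have [s s1 [_ Hs]] := lorenz_expand hT.
apply: (@geometric_escape R (fun k => 1 - iter k L (f0 q)) s) => // [|k].
  by rewrite /= subr_gt0.
have iterI : 0 <= iter k L (f0 q) <= 1.
  elim: k => [|k IH]; last exact: lower_map_range.
  by have [_ _ a b c] := lorenz_bounds hT; rewrite a andbT ltW ?(le_lt_trans b c).
have kq : q < iter k L (f0 q).
  by rewrite ltNge; apply/negP => qk; apply: H; exists k; rewrite /lower_itinerary ltNge qk.
move: kq iterI; rewrite [iter k.+1 _ _]/=.
move: (iter k L (f0 q)) => y qy /andP[y0 y1]; split; first by rewrite lerBlDr lerDl.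
rewrite /lower_map (leNgt y) qy /=.
have /andP[_ q1] := crit_range.
have := Hs 1 y; rewrite !in_itv /= lexx y1 (ltW qy) q1 => /(_ isT isT).
rewrite (lorenz_fix1 hT) !ger0_norm ?subr_ge0//.
by have /andP[] : 0 <= f1 y <= 1 by apply: branch1_range; rewrite ?y1 ?ltW.
Qed.

End LorenzWords.

(** * Counting realized prefixes: ranks and their recursion under the shift *)

Section CylinderCount.
Context {R : realType}.
Variables (q : R) (f0 f1 : R -> R).
Hypothesis hT : is_lorenz q f0 f1.

Local Notation up := (upper_itinerary q f0 f1).
Local Notation lo := (lower_itinerary q f0 f1).
Local Notation itinerary_of := (itinerary_of q f0 f1).
Local Notation realized := (realized q f0 f1).

(** Upper itineraries suffice, since lower ones have the same prefixes by [prefixes_lower_upper]. *)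
Definition admissible n m : bool :=
  `[< exists2 x, 0 <= x <= 1 & code n (up x) = m >].

Definition rank n w : nat := \sum_(0 <= m < code n w) admissible n m.

Definition num_words n : nat := \sum_(0 <= m < 2 ^ n) admissible n m.

(** A code of length [n.+1] below [2 ^ n] has leading symbol 0, so this counts the words of length
    [n.+1] that start with 0. *)
Definition num_words0 n : nat := \sum_(0 <= m < 2 ^ n) admissible n.+1 m.

Lemma code_upper_lt n x y w : 0 <= x <= 1 -> 0 <= y <= 1 -> itinerary_of x w ->
  (code n (up y) < code n w)%N -> y < x.
Proof.
move=> /andP[x0 x1] /andP[y0 y1] xw; rewrite ltNge; apply: contraL => xy.
rewrite -leqNgt; apply: leq_trans (lex_le_upper hT x0 xy y1 n).
by apply: (itinerary_le_upper hT) => //; rewrite x0.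
Qed.

(** Prepending 0 loses no word left of [shift w]: a point [y] with smaller code lies left of
    [f0 x <= f0 q], hence has a preimage under [f0]. *)
Lemma admissible0 n x w m : 0 <= x <= 1 -> itinerary_of x w -> w 0%N = false ->
  (m < code n (shift w))%N -> admissible n.+1 m = admissible n m.
Proof.
move=> xI xw w0 mlt; have [xq xw'] := itinerary_shift0 xI xw w0.
have /andP[x0 x1] := xI; have /andP[q0 q1] := crit_range hT.
have fxI : 0 <= f0 x <= 1 by apply: (branch0_range hT); rewrite x0.
apply/asboolP/asboolP => -[y yI ym]; last first.
  have yfx : y < f0 x by apply: (code_upper_lt (n := n) fxI yI xw'); rewrite ym.
  have [|z zI zy] := @branch0_onto _ _ _ _ hT y.
    case/andP: yI => -> _ /=; apply: le_trans (ltW yfx) _.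
    move: xq; rewrite le_eqVlt => /predU1P[-> //|xq].
    by apply/ltW/(branch0_incr hT).
  have /andP[z0 zq] := zI.
  (* The case [z = q] must be excluded, because the upper map follows [f1] there. *)
  have zx : z < q.
    rewrite lt_neqAle zq andbT; apply/eqP => zE.
    move: yfx; rewrite -zy ltNge => /negP; apply.
    move: xq; rewrite le_eqVlt zE => /predU1P[-> //|xq].
    by apply/ltW/(branch0_incr hT).
  exists z; first by rewrite z0 (le_trans zq).
  by rewrite /= shift_upper /upper_map zx zy {1}/upper_itinerary /= leNgt zx mul0n.
exists (upper_map q f0 f1 y); first exact: upper_map_range.
move: ym; rewrite -shift_upper /=.
by case: (up y 0%N) => //= E; move: mlt; have := code_lt n (shift w); lia.
Qed.

(** By monotonicity, exactly the words not left of [shift (up q)] can follow a 1: the point [q]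
    itself realizes equality, and larger words have preimages under [f1]. *)
Lemma admissible1 n m : (m < 2 ^ n)%N ->
  admissible n.+1 (2 ^ n + m) = (code n (shift (up q)) <= m)%N && admissible n m.
Proof.
move=> mlt; have /andP[q0 q1] := crit_range hT.
apply/asboolP/andP => [[y yI /= ym]|[mge /asboolP[y yI ym]]].
  have y1 : up y 0%N.
    move: ym; case: (up y 0%N) => //=; have := code_lt n (shift (up y)); lia.
  have E : code n (shift (up y)) = m by move: ym; rewrite y1; lia.
  split.
    rewrite -E; apply: lex_le_shift; last first.
      by rewrite y1 /upper_itinerary /= lexx.
    by apply: (realized_ge_beta hT) => //; exact: realized_upper.
  apply/asboolP; exists (upper_map q f0 f1 y); first exact: upper_map_range.
  by rewrite -shift_upper.
have aux z : q <= z <= 1 -> code n (up (f1 z)) = m -> exists2 x,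
    0 <= x <= 1 & code n.+1 (up x) = (2 ^ n + m)%N.
  move=> /andP[zq z1] <-; exists z; first by rewrite z1 (le_trans q0).
  by rewrite /= shift_upper /upper_map ltNge zq {1}/upper_itinerary /= zq mul1n.
have [/andP[y0 y1] f1q] := (yI, lorenz_bounds hT); have [_ _ _ f1q0 _] := f1q.
move: mge; rewrite shift_beta leq_eqVlt => /predU1P[E|]; last rewrite -{1}ym => E.
  by apply: (aux q) => //; rewrite lexx.
have yq : f1 q < y.
  apply: (@code_upper_lt n y (f1 q) (up y)) => //; last by left.
  by apply: (branch1_range hT); rewrite lexx.
have [|z zI zy] := @branch1_onto _ _ _ _ hT y; first by rewrite ltW.
by apply: (aux z) => //; rewrite zy.
Qed.

Lemma sum_nat_bool_eq (m n : nat) (F G : nat -> bool) :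
  (forall i, (m <= i < n)%N -> F i = G i) ->
  (\sum_(m <= i < n) F i = \sum_(m <= i < n) G i)%N.
Proof. by move=> E; apply: eq_big_nat => i /E ->. Qed.

Lemma rank0 w : rank 0 w = 0%N.
Proof. by rewrite /rank big_geq. Qed.

Lemma rank_shift0 n w : realized w -> w 0%N = false ->
  rank n.+1 w = rank n (shift w).
Proof.
move=> [x xI xw] w0; rewrite /rank /= w0 mul0n add0n.
by apply: sum_nat_bool_eq => m /= mlt; apply: (admissible0 xI xw).
Qed.

(** The words left of [w] are those starting with 0 and those of the form 1v with v from
    [shift (up q)] included to [shift w] excluded. The additive form avoids truncated
    subtraction. *)
Lemma rank_shift1 n w : realized w -> w 0%N ->
  (rank n.+1 w + rank n (shift (up q)) = num_words0 n + rank n (shift w))%N.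
Proof.
move=> rw w0; have bw := realized_ge_beta hT rw w0.
have /(_ n) bw' : lex_le (shift (up q)) (shift w).
  by apply: lex_le_shift => //; rewrite w0 /upper_itinerary /= lexx.
rewrite /rank /= w0 mul1n (@big_cat_nat _ _ _ (2 ^ n)) ?leq_addr//= -addnA; congr (_ + _)%N.
rewrite -{1}[(2 ^ n)%N]add0n big_addn addKn.
rewrite (big_cat_nat (leq0n _) bw')//= [in RHS](big_cat_nat (leq0n _) bw')//=.
rewrite [X in (X + _ + _)%N]big_nat_cond big1 ?add0n => [|i /andP[/andP[_ il] _]].
  rewrite addnC; congr (_ + _)%N.
  apply: sum_nat_bool_eq => m /andP[ml mg].
  by rewrite addnC admissible1 ?ml// (ltn_trans mg) ?code_lt.
by rewrite addnC admissible1 ?(ltn_trans il) ?code_lt// leqNgt il.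
Qed.

(** The constant [E_n] of the rank recursion, taken in [R] so that the subtraction is not
    truncated. *)
Definition branch_weight n : R :=
  (num_words0 n)%:R - (rank n (shift (up q)))%:R.

Lemma rank_shift n w : realized w ->
  (rank n.+1 w)%:R = (rank n (shift w))%:R + (w 0%N)%:R * branch_weight n :> R.
Proof.
move=> rw; case w0 : (w 0%N); last by rewrite mul0r addr0 rank_shift0.
have /(congr1 (fun k => k%:R : R)) := rank_shift1 n rw w0.
by rewrite mul1r /branch_weight !natrD; lra.
Qed.

Lemma rank_homo n u v : lex_le u v -> (rank n u <= rank n v)%N.
Proof.
by move=> /(_ n) uv; rewrite /rank (big_cat_nat (leq0n _) uv)//= leq_addr.
Qed.

Lemma rank_words n : (rank n (fun=> true)).+1 = num_words n.
Proof.
rewrite /num_words -(code_ones n) big_nat_recr//= /rank.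
suff -> : admissible n (code n (fun=> true)) by rewrite addn1.
by apply/asboolP; exists 1; rewrite ?ler01 ?lexx ?(upper_one hT).
Qed.

Lemma rank_zeros n : rank n (fun=> false) = 0%N.
Proof. by rewrite /rank code_zeros big_geq. Qed.

Lemma rank_le_words n w : (rank n w <= num_words n)%N.
Proof.
by rewrite /num_words (@big_cat_nat _ _ _ (code n w)) ?leq_addr// ltnW ?code_lt.
Qed.

(** The words left of [up q] are all those starting with 0, and the last of these is the prefix of
    [lo q]. *)
Lemma rank_crit n : rank n.+1 (up q) = (rank n.+1 (lo q)).+1.
Proof.
have a0 : lo q 0%N = false by rewrite /lower_itinerary /= ltxx.
have b0 : up q 0%N by rewrite /upper_itinerary /= lexx.
have qI := crit_range hT.
have E : rank n.+1 (up q) = num_words0 n.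
  by have := rank_shift1 n (realized_upper _ _ _ qI) b0; lia.
have alt := code_lt n (shift (lo q)).
rewrite E /num_words0 /rank /= a0 mul0n add0n.
rewrite (@big_cat_nat _ _ _ (code n (shift (lo q))).+1)//=.
rewrite big_nat_recr//= [X in (_ + X)%N]big_nat_cond [X in (_ + X)%N]big1 => [|i].
  suff -> : admissible n.+1 (code n (shift (lo q))) by rewrite addn1 addn0.
  (* Admissibility refers to upper itineraries, so the prefix of [lo q] is traded for an equal upper
     prefix. *)
  have /setP/(_ (prefix_of n.+1 (lo q))) := prefixes_lower_upper n.+1 hT.
  rewrite !inE => E'; have : prefix_of n.+1 (lo q) \in prefix_of n.+1 @` lower_address q f0 f1.
    by apply: mem_set; exists (lo q) => //; exists q => //=; rewrite in_itv.
  rewrite E' => /set_mem[w [x]]; rewrite /= in_itv /= => xI <- H.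
  exists x => //; have -> : code n (shift (lo q)) = code n.+1 (lo q) by rewrite /= a0.
  rewrite -[LHS]/(code n.+1 (up x)).
  apply: eq_code => k kn; have := congr1 (fun t => tnth t (Ordinal kn)) H.
  by rewrite !tnth_mktuple.
move=> /andP[/andP[ig il] _]; case H : (admissible _ _) => //.
move/asboolP : H => [x xI xi].
have x0 : up x 0%N = false.
  by move: xi => /=; case: (up x 0%N) => //=; lia.
have := realized_le_alpha hT (realized_upper _ _ _ xI) x0 n.+1.
by rewrite xi /= a0; lia.
Qed.

End CylinderCount.

(** * Subadditivity and the exponential growth rate of the word count *)

Lemma fekete {R : realType} (u : nat -> R) : (forall n, 0 <= u n) ->
  (forall m n, u (m + n)%N <= u m + u n) ->
  exists l : R, [/\ 0 <= l, u n / n%:R @[n --> \oo] --> l & forall n, l * n%:R <= u n].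
Proof.
(* The limit is the infimum of [u n / n] over positive [n], which also yields the lower bound at
   every [n]. *)
move=> u0 uD; pose A := [set u n.+1 / n.+1%:R | n in [set: nat]].
have A0 : lbound A 0 by move=> _ [n _ <-]; rewrite divr_ge0.
have Ainf : has_inf A by split; [exists (u 1%N / 1), 0%N|exists 0].
exists (inf A); have lA n : inf A * n%:R <= u n.
  case: n => [|n]; first by rewrite mulr0.
  by rewrite -ler_pdivlMr ?ltr0n//; apply: (ge_inf Ainf.2); exists n.
split => //; first by apply: lb_le_inf => //; exact: Ainf.1.
apply/cvgrPdist_le => e e0.
have [_ [m _ <-] Hm] := inf_adherent (divr_gt0 e0 (ltr0n R 2)) Ainf.
(* Writing [n = k * m.+1 + r], the remainder costs at most the constant [M]. The choice of [m] and
   the quotient [M / n] each use half of [e]. *)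
pose M := \sum_(r < m.+1) u r.
have uM k r : (r < m.+1)%N -> u (k * m.+1 + r)%N <= k%:R * u m.+1 + M.
  move=> rm; elim: k => [|k IH].
    rewrite mul0n mul0r !add0r /M (bigD1 (Ordinal rm))//= lerDl.
    by apply: sumr_ge0.
  rewrite mulSn -addnA; apply: le_trans (uD _ _) _.
  by rewrite -natr1 mulrDl mul1r; lra.
have M0 : 0 <= M by apply: sumr_ge0.
have HN : \forall n \near \oo, M / (e / 2) < n%:R by exact: nbhs_infty_gtr.
near=> n.
have n0 : 0 < n%:R :> R by rewrite ltr0n; near: n; exists 1%N.
rewrite distrC ger0_norm; last by rewrite subr_ge0 ler_pdivlMr.
rewrite lerBlDr ler_pdivrMr//.
have Mn : M < n%:R * (e / 2).
  by rewrite -ltr_pdivrMr ?divr_gt0//; near: n.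
rewrite {1}(divn_eq n m.+1); apply: le_trans (uM _ _ _) _; first by rewrite ltn_mod.
have km : (n %/ m.+1)%:R * m.+1%:R <= n%:R :> R by rewrite -natrM ler_nat leq_divM.
have : u m.+1 <= m.+1%:R * (inf A + e / 2) by rewrite mulrC -ler_pdivrMr ?ltr0n// ltW.
move=> /(ler_wpM2l (ler0n R (n %/ m.+1))).
have lA0 : 0 <= inf A + e / 2.
  by rewrite addr_ge0 ?divr_ge0 ?(ltW e0)//; apply: lb_le_inf => //; exact: Ainf.1.
have := ler_wpM2r lA0 km; rewrite -mulrA => H1 H2.
by have := le_trans H2 H1; lra.
Unshelve. all: by end_near.
Qed.

Lemma mem_prefixesP n (A : set bitstream) (u : n.-tuple bool) :
  reflect (exists2 w, A w & prefix_of n w = u) (u \in prefixes n A).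
Proof. by rewrite finset.in_set; apply: (iffP idP) => [/set_mem|/mem_set]. Qed.

Lemma nth_prefix n w k : (k < n)%N -> nth false (prefix_of n w) k = w k.
Proof.
move=> kn; rewrite -[k in LHS]/(nat_of_ord (Ordinal kn)) -tnth_nth.
by rewrite tnth_mktuple.
Qed.

(** A word is determined by its two pieces, and the second piece is a prefix of a shifted element of
    [A]. *)
Lemma card_prefixes_cat (A : set bitstream) m n : (forall w, A w -> A (shift w)) ->
  (#|prefixes (m + n) A| <= #|prefixes m A| * #|prefixes n A|)%N.
Proof.
move=> As; rewrite -cardsX.
pose f (t : (m + n).-tuple bool) :=
  ([tuple tnth t (lshift n i) | i < m], [tuple tnth t (rshift m i) | i < n]).
have f_inj : injective f.
  move=> s t E; apply: eq_from_tnth => i; rewrite -(splitK i).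
  case: (fintype.split i) => j /=.
    by have := congr1 (fun p => tnth p.1 j) E; rewrite !tnth_mktuple.
  by have := congr1 (fun p => tnth p.2 j) E; rewrite !tnth_mktuple.
rewrite -(card_imset _ f_inj); apply/subset_leq_card/fintype.subsetP => _ /imsetP[t tA ->].
have /mem_prefixesP[w wA <-] := tA; rewrite finset.in_setX.
apply/andP; split; apply/mem_prefixesP.
  by exists w => //; apply: eq_from_tnth => i; rewrite !tnth_mktuple.
exists (iter m shift w); first by elim: (m) => //= k; apply: As.
by apply: eq_from_tnth => i; rewrite !tnth_mktuple iter_shift.
Qed.

Section Entropy.
Context {R : realType}.
Variables (q : R) (f0 f1 : R -> R).
Hypothesis hT : is_lorenz q f0 f1.

Local Notation up := (upper_itinerary q f0 f1).
Local Notation num_words := (num_words q f0 f1).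
Local Notation h := (lorenz_entropy q f0 f1).

Lemma num_wordsE n : num_words n = #|prefixes n (upper_address q f0 f1)|.
Proof.
have codeN (t : n.-tuple bool) : (code n (nth false t) < 2 ^ n)%N by exact: code_lt.
pose f t := Ordinal (codeN t).
have f_inj : injective f.
  move=> s t /(congr1 val) /= E; apply: eq_from_tnth => i.
  by rewrite !(tnth_nth false) (code_prefix E).
rewrite -(card_imset _ f_inj) /num_words big_mkord -big_mkcond sum1dep_card.
apply: eq_card => i; rewrite finset.in_set; apply/asboolP/imsetP => [[x xI xi]|[t]].
  exists (prefix_of n (up x)).
    by apply/mem_prefixesP; exists (up x) => //; exists x => //=; rewrite in_itv.
  apply: val_inj => /=; rewrite -xi; apply: eq_code => k kn.
  by rewrite nth_prefix.
move=> /mem_prefixesP[w [x]]; rewrite /= in_itv /= => xI <- <- ->; exists x => //=.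
by apply: eq_code => k kn; rewrite nth_prefix.
Qed.

Lemma num_words_gt0 n : (0 < num_words n)%N.
Proof. by rewrite -(rank_words hT). Qed.

Lemma num_wordsD m n : (num_words (m + n) <= num_words m * num_words n)%N.
Proof.
rewrite !num_wordsE; apply: card_prefixes_cat => _ [x xI <-].
rewrite shift_upper; exists (upper_map q f0 f1 x) => //.
by move: xI; rewrite /= !in_itv /=; exact: upper_map_range.
Qed.

(** [fekete] applied to the logarithm of the submultiplicative word count. The last clause makes
    [expR h ^+ n] a lower bound at every length, not only asymptotically. *)
Lemma entropy_spec : [/\ 0 <= h,
  ln (num_words n)%:R / n%:R @[n --> \oo] --> h &
  forall n, h * n%:R <= ln (num_words n)%:R].
Proof.
have [|m n|l [l0 cl Hl]] := @fekete R (fun n => ln (num_words n)%:R).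
- by move=> n; rewrite ln_ge0// ler1n num_words_gt0.
- rewrite -lnM ?posrE ?ltr0n ?num_words_gt0// -natrM ler_ln ?posrE ?ltr0n ?muln_gt0 ?num_words_gt0//.
  by rewrite ler_nat num_wordsD.
suff -> : h = l by [].
rewrite /lorenz_entropy /entropy; apply: cvg_lim => //.
by under eq_fun do rewrite -num_wordsE.
Qed.

Lemma num_words_ge n : expR h ^+ n <= (num_words n)%:R.
Proof.
have [_ _ /(_ n) H] := entropy_spec.
by rewrite -expRM_natl mulrC -[X in _ <= X]lnK ?ler_expR// posrE ltr0n num_words_gt0.
Qed.

Lemma num_words_le b : expR h < b ->
  \forall n \near \oo, (num_words n)%:R <= b ^+ n.
Proof.
move=> hb; have b0 : 0 < b by apply: lt_trans hb; exact: expR_gt0.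
have hlnb : h < ln b by rewrite -ltr_expR lnK.
have [_ /cvgr_lt /(_ _ hlnb) H _] := entropy_spec.
near=> n.
have n0 : 0 < n%:R :> R by rewrite ltr0n; near: n; exists 1%N.
rewrite -ler_ln ?posrE ?ltr0n ?num_words_gt0 ?exprn_gt0// lnXn// -[X in _ <= X]mulr_natr.
by rewrite -ler_pdivrMr// ltW//; near: n.
Unshelve. all: by end_near.
Qed.

End Entropy.

(** * The coding map as a normalised expansion in base [a] *)

Section Coding.
Context {R : realType}.
Variable a : R.
Hypothesis a1 : 1 < a.

Let z0 : 0 < a^-1. Proof. by rewrite invr_gt0 (lt_trans _ a1). Qed.
Let z1 : a^-1 < 1. Proof. by rewrite invf_lt1 // (lt_trans _ a1). Qed.

Let digit (w : bitstream) k : R := (w k)%:R * a ^- k.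

Let digit_ge0 w k : 0 <= digit w k.
Proof. by rewrite mulr_ge0// -exprVn exprn_ge0// ltW. Qed.

Let digit_le w k : digit w k <= geometric 1 a^-1 k.
Proof.
rewrite /digit /geometric /= mul1r -exprVn ler_piMl//.
  by rewrite exprn_ge0// ltW.
by rewrite lern1 leq_b1.
Qed.

Let norm_z : `|a^-1| < 1. Proof. by rewrite ger0_norm// ltW. Qed.

Let is_cvg_digits w : cvgn (series (digit w)).
Proof.
apply: (series_le_cvg (digit_ge0 w) _ (digit_le w)).
  by move=> n; rewrite /geometric /= mul1r exprn_ge0// ltW.
exact: is_cvg_geometric_series.
Qed.

Lemma coding_ge0 w : 0 <= coding a w.
Proof.
rewrite mulr_ge0 ?subr_ge0 ?(ltW z1)//; apply: limr_ge; first exact: is_cvg_digits.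
by apply: nearW => n; apply: sumr_ge0 => k _; exact: digit_ge0.
Qed.

Lemma coding_le1 w : coding a w <= 1.
Proof.
have d0 : 0 < 1 - a^-1 by rewrite subr_gt0.
rewrite -(@divff _ (1 - a^-1)) ?gt_eqF// ler_wpM2l ?(ltW d0)//.
rewrite -[leRHS]mul1r -(cvg_lim _ (cvg_geometric_series (a := 1) norm_z))//.
apply: lim_series_le => [||n]; [exact: is_cvg_digits| |exact: digit_le].
exact: is_cvg_geometric_series.
Qed.

(** From here on, this functional equation and the bounds 0 and 1 replace the series. *)
Lemma coding_shift w :
  coding a w = (1 - a^-1) * (w 0%N)%:R + a^-1 * coding a (shift w).
Proof.
rewrite /coding mulrCA -mulrDr; congr (_ * _); apply: cvg_lim => //.
rewrite -(cvg_shiftS (series (digit w))).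
have -> : (fun n => series (digit w) n.+1) =
    (fun n => (w 0%N)%:R + a^-1 * series (digit (shift w)) n).
  apply: funext => n; rewrite /series /= big_nat_recl// {1}/digit expr0 invr1 mulr1.
  congr (_ + _); rewrite mulr_sumr; apply: eq_bigr => i _.
  by rewrite /digit /shift -!exprVn exprS mulrCA.
by apply: cvgD; [exact: cvg_cst|apply: cvgMl_tmp; exact: is_cvg_digits].
Qed.

Lemma coding_zeros : coding a (fun=> false) = 0.
Proof. by have := coding_shift (fun=> false); rewrite mulr0 add0r; have := z1; nra. Qed.

Lemma coding_ones : coding a (fun=> true) = 1.
Proof. by have := coding_shift (fun=> true); rewrite mulr1; have := z1; nra. Qed.

Lemma coding_gt0 (w : bitstream) k : w k -> 0 < coding a w.
Proof.
elim: k w => [|k IH] w wk; rewrite coding_shift.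
  by rewrite wk mulr1 ltr_pwDl ?subr_gt0// mulr_ge0 ?coding_ge0 ?ltW.
rewrite ltr_wpDl ?mulr_ge0 ?subr_ge0 ?(ltW z1)//.
by rewrite mulr_gt0// IH.
Qed.

Lemma coding_lt1 (w : bitstream) k : w k = false -> coding a w < 1.
Proof.
elim: k w => [|k IH] w wk; rewrite coding_shift.
  rewrite wk mulr0 add0r; have := coding_le1 (shift w); have := z0; have := z1; nra.
have w01 : (w 0%N)%:R <= 1 :> R by rewrite lern1 leq_b1.
have := IH (shift w) wk; have := z0; have := z1; nra.
Qed.

End Coding.

(** The contraction principle behind the comparisons of codings below: each shift gains a factor
    [a^-1] on a bounded quantity. *)
Lemma le_expr_le0 {R : archiRealFieldType} (a x : R) : 1 < a ->
  (forall n, x <= a^-1 ^+ n) -> x <= 0.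
Proof.
move=> a1 H; rewrite leNgt; apply/negP => x0.
have [n] := expr_unbounded x^-1 a1.
rewrite -[X in X < _]div1r ltr_pdivrMr// => Hn.
have an : 0 < a ^+ n by rewrite exprn_gt0// (lt_trans _ a1).
by have := H n; rewrite exprVn -[X in _ <= X]div1r ler_pdivlMr// leNgt mulrC Hn.
Qed.

(** * Uniform Lorenz maps and their itineraries *)

Section Uniform.
Context {R : realType}.
Variables a p : R.
Hypothesis a12 : 1 < a < 2.
Hypothesis hp : 1 - a^-1 < p < a^-1.

Let a1 : 1 < a. Proof. by case/andP: a12. Qed.
Let a0 : 0 < a. Proof. exact: lt_trans a1. Qed.
Let z0 : 0 < a^-1. Proof. by rewrite invr_gt0. Qed.
Let z1 : a^-1 < 1. Proof. by rewrite invf_lt1. Qed.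
Let aK : a * a^-1 = 1. Proof. by rewrite mulfV// gt_eqF. Qed.

Lemma unif_lorenz : is_lorenz p (unif0 a) (unif1 a).
Proof.
have [p1 p2] := andP hp.
have p0 : 0 < p by have := z1; lra.
have p3 : p < 1 by have := z1; lra.
have ap : a * p < 1 by rewrite -aK ltr_pM2l.
have ap' : a - 1 < a * p.
  by have := ltr_pM2l a0 (1 - a^-1) p; rewrite p1 mulrBr mulr1 aK => ->.
split => //.
- by rewrite p0.
- move=> x; rewrite !in_itv /= /unif0 => /andP[x0 xp]; rewrite mulr_ge0 ?(ltW a0)//=.
  by have := ler_wpM2l (ltW a0) xp; lra.
- move=> x; rewrite !in_itv /= /unif1 => /andP[px x1].
  by have := ler_wpM2l (ltW a0) px; have := ler_wpM2l (ltW a0) x1; lra.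
- apply: continuous_subspaceT => x; apply: cvgM; [exact: cvg_cst|exact: cvg_id].
- apply: continuous_subspaceT => x; apply: cvgB; last exact: cvg_cst.
  apply: cvgD; last exact: cvg_cst.
  by apply: cvgM; [exact: cvg_cst|exact: cvg_id].
- by move=> x y _ _ xy; rewrite /unif0 ltr_pM2l.
- by move=> x y _ _ xy; rewrite /unif1 ltrD2r ltrD2r ltr_pM2l.
- by rewrite /unif0 mulr0.
- by rewrite /unif1 mulr1 addrAC subrr add0r.
- by apply/orP; left; rewrite /unif0 /unif1 ap /=; move: ap'; have := a1; lra.
- exists a => //; split => x y _ _.
    by rewrite /unif0 -mulrBr normrM (gtr0_norm a0).
  have -> : unif1 a x - unif1 a y = a * (x - y) by rewrite /unif1; lra.
  by rewrite normrM (gtr0_norm a0).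
Qed.

Local Notation itinerary_of := (itinerary_of p (unif0 a) (unif1 a)).

(** [coding_shift] applies the inverse of the uniform branch selected by the first symbol, so the
    error contracts by [a^-1] at each step. *)
Lemma coding_unif x w : 0 <= x <= 1 -> itinerary_of x w -> coding a w = x.
Proof.
move=> xI xw; suff : `|coding a w - x| <= 0 by rewrite normr_le0 subr_eq0 => /eqP.
apply: (le_expr_le0 a1) => n; elim: n x w xI xw => [|n IH] x w xI xw.
  have := coding_ge0 a1 w; have := coding_le1 a1 w.
  by rewrite expr0 ler_norml; case/andP: xI; lra.
have step y : 0 <= y <= 1 -> itinerary_of y (shift w) ->
    coding a w - x = a^-1 * (coding a (shift w) - y) ->
    `|coding a w - x| <= a^-1 ^+ n.+1.
  by move=> yI yw ->; rewrite normrM gtr0_norm// exprS ler_wpM2l ?IH// ltW.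
case w0 : (w 0%N).
  have [px xw'] := itinerary_shift1 xI xw w0.
  apply: (step _ _ xw').
    by apply: (branch1_range unif_lorenz); rewrite px; case/andP: xI.
  by rewrite coding_shift// w0 /unif1 mulr1; field; rewrite gt_eqF.
have [px xw'] := itinerary_shift0 xI xw w0.
apply: (step _ _ xw').
  by apply: (branch0_range unif_lorenz); rewrite px; case/andP: xI => ->.
by rewrite coding_shift// w0 /unif0 mulr0 add0r; field; rewrite gt_eqF.
Qed.

(** When each first symbol tells the side of [p] on which the coding lies, the orbit of [coding a w]
    consists of the codings of the shifts of [w]. *)
Lemma unif_lower_coding w :
  (forall k, iter k shift w 0%N = (p < coding a (iter k shift w))) ->
  unif_lower_itinerary a p (coding a w) = w.
Proof.
move=> H; apply: funext => k; rewrite /unif_lower_itinerary /lower_itinerary.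
suff -> : iter k (lower_map p (unif0 a) (unif1 a)) (coding a w) = coding a (iter k shift w).
  by rewrite -H iter_shift addn0.
elim: k => //= k ->; have := coding_shift a1 (iter k shift w).
rewrite H /lower_map leNgt; case: (p < _) => /= E.
  by rewrite /unif1 E; field; rewrite gt_eqF.
by rewrite /unif0 E; rewrite mulr0 add0r mulrA aK mul1r.
Qed.

Lemma unif_upper_coding w :
  (forall k, iter k shift w 0%N = (p <= coding a (iter k shift w))) ->
  unif_upper_itinerary a p (coding a w) = w.
Proof.
move=> H; apply: funext => k; rewrite /unif_upper_itinerary /upper_itinerary.
suff -> : iter k (upper_map p (unif0 a) (unif1 a)) (coding a w) = coding a (iter k shift w).
  by rewrite -H iter_shift addn0.
elim: k => //= k ->; have := coding_shift a1 (iter k shift w).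
rewrite H /upper_map ltNge; case: (p <= _) => /= E.
  by rewrite /unif1 E; field; rewrite gt_eqF.
by rewrite /unif0 E; rewrite mulr0 add0r mulrA aK mul1r.
Qed.

End Uniform.

(** * Entropy below [ln a]: the weight series recovers the coding map *)

Section SmallEntropy.
Context {R : realType}.
Variables (q : R) (f0 f1 : R -> R) (a : R).
Hypothesis hT : is_lorenz q f0 f1.
Hypothesis a1 : 1 < a.
Hypothesis ha : expR (lorenz_entropy q f0 f1) < a.

Local Notation up := (upper_itinerary q f0 f1).
Local Notation lo := (lower_itinerary q f0 f1).
Local Notation realized := (realized q f0 f1).
Local Notation rank := (rank q f0 f1).
Local Notation num_words := (num_words q f0 f1).

Let a0 : 0 < a. Proof. exact: lt_trans a1. Qed.
Let z0 : 0 < a^-1. Proof. by rewrite invr_gt0. Qed.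
Let z1 : a^-1 < 1. Proof. by rewrite invf_lt1. Qed.

Let zn0 n : 0 <= a^-1 ^+ n. Proof. by rewrite exprn_ge0// ltW. Qed.

Let words n : R := (num_words n)%:R * a^-1 ^+ n.
Let ranks w n : R := (rank n w)%:R * a^-1 ^+ n.
Let weight w : R := limn (series (ranks w)).

Let is_cvg_words : cvgn (series words).
Proof.
(* An intermediate rate [b] leaves the convergent ratio [b / a]; the constant [M] below absorbs the
   finitely many early lengths. *)
pose b := (expR (lorenz_entropy q f0 f1) + a) / 2.
have hb : expR (lorenz_entropy q f0 f1) < b by rewrite /b (midf_lt ha).
have ba : b < a by rewrite /b (midf_lt ha).
have b0 : 0 < b by apply: lt_trans hb; exact: expR_gt0.
clearbody b; have [N _ HN] := num_words_le hT hb.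
pose M : R := 1 + \sum_(k < N) (num_words k)%:R / b ^+ k.
have M1 : 1 <= M.
  by rewrite lerDl; apply: sumr_ge0 => k _; rewrite divr_ge0// exprn_ge0// ltW.
have HM n : (num_words n)%:R <= M * b ^+ n.
  have [Nn|nN] := leqP N n.
    by apply: le_trans (HN n Nn) _; rewrite ler_peMl// exprn_ge0// ltW.
  rewrite -ler_pdivrMr ?exprn_gt0// /M (bigD1 (Ordinal nN))//= addrCA lerDl.
  rewrite addr_ge0//; apply: sumr_ge0 => k _.
  by rewrite divr_ge0// exprn_ge0// ltW.
apply: (@series_le_cvg _ _ (geometric M (b / a))) => [n|n|n|].
- by rewrite mulr_ge0.
- by apply: mulr_ge0; [exact: le_trans M1|rewrite exprn_ge0// divr_ge0// ltW].
- by rewrite /geometric /= exprMn mulrA ler_wpM2r// HM.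
- apply: is_cvg_geometric_series; rewrite ger0_norm ?divr_ge0 ?(ltW a0) ?(ltW b0)//.
  by rewrite ltr_pdivrMr// mul1r.
Qed.

Let ranks_ge0 w n : 0 <= ranks w n. Proof. by rewrite mulr_ge0. Qed.

Let ranks_le w n : ranks w n <= words n.
Proof. by rewrite ler_wpM2r// ler_nat rank_le_words. Qed.

Let is_cvg_ranks w : cvgn (series (ranks w)).
Proof.
apply: (series_le_cvg (ranks_ge0 w) _ (ranks_le w) is_cvg_words) => n.
by rewrite mulr_ge0.
Qed.

Let weight_ge0 w : 0 <= weight w.
Proof.
apply: limr_ge; first exact: is_cvg_ranks.
by apply: nearW => n; apply: sumr_ge0.
Qed.

Let weight_le w : weight w <= limn (series words).
Proof.
by apply: lim_series_le => [||n]; [exact: is_cvg_ranks|exact: is_cvg_words|exact: ranks_le].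
Qed.

Let weight_homo u v : lex_le u v -> weight u <= weight v.
Proof.
move=> uv; apply: lim_series_le => [||n]; try exact: is_cvg_ranks.
by rewrite ler_wpM2r// ler_nat rank_homo.
Qed.

(** By [rank_crit], every term from length 1 on is larger at [up q], and length 1 alone contributes
    [a^-1]. *)
Let weight_crit : weight (lo q) < weight (up q).
Proof.
apply: (@lt_le_trans _ _ (weight (lo q) + a^-1)); first by rewrite ltrDl.
have cl : series (ranks (lo q)) n + a^-1 @[n --> \oo] --> weight (lo q) + a^-1.
  by apply: cvgD; [exact: is_cvg_ranks|exact: cvg_cst].
rewrite -(cvg_lim _ cl)//; apply: ler_lim; [by apply/cvg_ex; exists (weight (lo q) + a^-1)|exact: is_cvg_ranks|].
exists 2%N => // -[//|[//|n]] _; rewrite /series /= !big_nat_recl//.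
rewrite /ranks (rank_crit hT 0) -natr1 expr1 mulrDl mul1r !rank0.
rewrite !mul0r !add0r -addrA [X in _ + X <= _]addrC addrA lerD2l; apply: ler_sum => i _.
by rewrite ler_wpM2r// ler_nat (rank_crit hT) leqW.
Qed.

(** The constant [K] of the functional equation of the weight, read off at [up q], whose first
    symbol is 1. *)
Let jump := weight (up q) - a^-1 * weight (shift (up q)).

Let weight_shift w : realized w ->
  weight w = a^-1 * weight (shift w) + (w 0%N)%:R * jump.
Proof.
pose E n := \sum_(0 <= k < n) branch_weight q f0 f1 k * a^-1 ^+ k.
have serS v n : realized v ->
    series (ranks v) n.+1 = a^-1 * series (ranks (shift v)) n + (v 0%N)%:R * (a^-1 * E n).
  move=> rv; rewrite /series /= big_nat_recl// /ranks rank0 mul0r add0r.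
  rewrite mulrCA -mulrDr mulr_sumr -big_split /= mulr_sumr.
  by apply: eq_bigr => k _; rewrite (rank_shift hT)// exprS; ring.
have rb := realized_upper q f0 f1 (crit_range hT).
have b0 : up q 0%N by rewrite /upper_itinerary /= lexx.
(* Solving the recursion at [up q] for [E n] shows that these sums converge and identifies their
   limit. *)
have cE : a^-1 * E n @[n --> \oo] --> jump.
  have -> : (fun n => a^-1 * E n) =
      (fun n => series (ranks (up q)) n.+1 - a^-1 * series (ranks (shift (up q))) n).
    by apply: funext => n; rewrite serS// b0 mul1r addrC addKr.
  apply: cvgB; last by apply: cvgMl_tmp; exact: is_cvg_ranks.
  by rewrite (cvg_shiftS (series (ranks (up q)))); exact: is_cvg_ranks.
move=> rw; apply: cvg_lim => //; rewrite -(cvg_shiftS (series (ranks w))).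
have -> : (fun n => series (ranks w) n.+1) =
    (fun n => a^-1 * series (ranks (shift w)) n + (w 0%N)%:R * (a^-1 * E n)).
  by apply: funext => n; rewrite serS.
apply: cvgD; first by apply: cvgMl_tmp; exact: is_cvg_ranks.
exact: cvgMl_tmp.
Qed.

(** Both sides obey the same affine recursion, so their difference at [w] is [a^-1] times the one at
    [shift w], while [B] bounds it everywhere. *)
Let weight_coding w : realized w -> (1 - a^-1) * weight w = jump * coding a w.
Proof.
move=> rw; pose D w := (1 - a^-1) * weight w - jump * coding a w.
pose B := limn (series words) + `|jump| + 1.
have B0 : 0 < B.
  by rewrite /B ltr_wpDl// addr_ge0// (le_trans (weight_ge0 w) (weight_le w)).
suff : `|D w| / B <= 0.
  rewrite pmulr_lle0 ?invr_gt0// normr_le0 => /eqP /subr0_eq; exact.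
apply: (le_expr_le0 a1) => n; rewrite ler_pdivrMr//.
elim: n w rw => [|n IH] w rw.
  rewrite expr0 mul1r; apply: le_trans (ler_normB _ _) _.
  rewrite normrM (ger0_norm (weight_ge0 w)) ger0_norm ?subr_ge0 ?(ltW z1)//.
  rewrite normrM (ger0_norm (coding_ge0 a1 w)) /B.
  have := weight_ge0 w; have := weight_le w; have := coding_le1 a1 w.
  have := coding_ge0 a1 w; have := normr_ge0 jump.
  by move: z0 z1; nra.
have -> : D w = a^-1 * D (shift w).
  by rewrite /D weight_shift// coding_shift//; ring.
rewrite normrM gtr0_norm// exprS -mulrA ler_wpM2l ?(ltW z0)//.
exact/IH/realized_shift.
Qed.

(** The all-ones word has coding 1, so [jump] is a positive multiple of its weight, which is at
    least that of [up q] and thus exceeds that of [lo q]. *)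
Let jump_gt0 : 0 < jump.
Proof.
have I1 : 0 <= (1 : R) <= 1 by rewrite ler01 lexx.
have r1 := realized_upper q f0 f1 I1.
have := weight_coding r1; rewrite (upper_one hT) (coding_ones a1) mulr1 => <-.
rewrite mulr_gt0 ?subr_gt0//.
apply: le_lt_trans (weight_ge0 (lo q)) _; apply: lt_le_trans weight_crit _.
rewrite -(upper_one hT); apply: weight_homo.
by apply: (realized_ge_beta hT) => //; rewrite upper_one.
Qed.

Lemma coding_homo u v : realized u -> realized v -> lex_le u v ->
  coding a u <= coding a v.
Proof.
move=> ru rv uv; rewrite -(ler_pM2l jump_gt0) -!weight_coding//.
by rewrite ler_wpM2l ?subr_ge0 ?(ltW z1)// weight_homo.
Qed.

Lemma coding_crit_lt : coding a (lo q) < coding a (up q).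
Proof.
have qI := crit_range hT.
rewrite -(ltr_pM2l jump_gt0) -!weight_coding; [|exact: realized_upper|exact: realized_lower].
by rewrite ltr_pM2l ?subr_gt0.
Qed.

End SmallEntropy.

(** * A separating point and the entropy bound it forces *)

Section SeparatingPoint.
Context {R : realType}.
Variables (q : R) (f0 f1 : R -> R) (a : R).
Hypothesis hT : is_lorenz q f0 f1.
Hypothesis a1 : 1 < a.

Local Notation up := (upper_itinerary q f0 f1).
Local Notation lo := (lower_itinerary q f0 f1).
Local Notation realized := (realized q f0 f1).
Local Notation rank := (rank q f0 f1).
Local Notation num_words := (num_words q f0 f1).

(** Weak inequalities let the notion apply to the codings of [lo q] and [up q] themselves as well as
    to points between them. *)
Definition separates p := forall w, realized w ->
  if w 0%N then p <= coding a w else coding a w <= p.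

Let a0 : 0 < a. Proof. exact: lt_trans a1. Qed.
Let z0 : 0 < a^-1. Proof. by rewrite invr_gt0. Qed.

(** While first symbols agree, the difference of codings contracts by [a^-1]; at the first
    disagreement [p] lies between the two codings. *)
Lemma separates_homo p u v : separates p -> realized u -> realized v ->
  lex_le u v -> coding a u <= coding a v.
Proof.
move=> sp ru rv uv; rewrite -subr_le0; apply: (le_expr_le0 a1) => n.
elim: n u v ru rv uv => [|n IH] u v ru rv uv.
  by have := coding_le1 a1 u; have := coding_ge0 a1 v; rewrite expr0; lra.
have [E|neq] := eqVneq (u 0%N) (v 0%N).
  have -> : coding a u - coding a v = a^-1 * (coding a (shift u) - coding a (shift v)).
    by rewrite (coding_shift a1 u) (coding_shift a1 v) E; ring.
  rewrite exprS ler_wpM2l ?(ltW z0)//; apply: IH; try exact: realized_shift.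
  exact: lex_le_shift.
apply: (@le_trans _ _ 0); last by rewrite exprn_ge0// ltW.
rewrite subr_le0; move: neq (lex_le_head uv) (sp _ ru) (sp _ rv).
by case: (u 0%N); case: (v 0%N) => // _; [move=> /(_ isT)|move=> _; exact: le_trans].
Qed.

(* rank k.+1 w - rank k w counts the boundaries to the left of w between words
   that first differ at time k. *)
Let gaps n w : R :=
  \sum_(0 <= k < n) a^-1 ^+ k * ((rank k.+1 w)%:R - (rank k w)%:R).

Let gaps_shift n : exists G, forall w, realized w ->
  gaps n.+1 w = a^-1 * gaps n (shift w) + (w 0%N)%:R * G.
Proof.
pose E := branch_weight q f0 f1.
exists (E 0%N + a^-1 * \sum_(0 <= k < n) a^-1 ^+ k * (E k.+1 - E k)) => w rw.
rewrite /gaps big_nat_recl// expr0 mul1r (rank_shift hT)// !rank0 add0r subr0.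
rewrite [in RHS]mulrDr addrCA; congr (_ + _).
rewrite mulrCA -mulrDr /gaps !mulr_sumr -big_split /= mulr_sumr.
by apply: eq_bigr => k _; rewrite !(rank_shift hT _ rw) exprS -/E; ring.
Qed.

(** [rank_crit] shifts both ranks by one for every positive [k], so only the term [k = 0]
    differs. *)
Let gaps_crit n : gaps n.+1 (up q) = gaps n.+1 (lo q) + 1.
Proof.
rewrite /gaps !big_nat_recl// expr0 !mul1r !rank0 !subr0 (rank_crit hT) -natr1.
rewrite addrAC; congr (_ + _ + _); apply: eq_bigr => k _.
by rewrite !(rank_crit hT) -!natr1; ring.
Qed.

(** For equal first symbols [G] cancels and everything scales by [a^-1]. Otherwise [lo q] and [up q]
    are inserted between [u] and [v], and the middle piece is one gap of length [J]. *)
Let gaps_le p n u v : separates p -> realized u -> realized v -> lex_le u v ->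
  (coding a (up q) - coding a (lo q)) * (gaps n v - gaps n u) <=
  coding a v - coding a u.
Proof.
move=> sp; set J := coding a (up q) - coding a (lo q).
elim: n u v => [|n IH] u v ru rv uv.
  by rewrite /gaps !big_geq// subrr mulr0 subr_ge0 (separates_homo sp).
have [G HG] := gaps_shift n.
have same w x : realized w -> realized x -> lex_le w x -> w 0%N = x 0%N ->
    J * (gaps n.+1 x - gaps n.+1 w) <= coding a x - coding a w.
  move=> rw rx wx E; rewrite !HG// E (coding_shift a1 w) (coding_shift a1 x) E.
  have := IH _ _ (realized_shift hT rw) (realized_shift hT rx) (lex_le_shift wx E).
  by move=> /(ler_wpM2l (ltW z0)); lra.
have [E|neq] := eqVneq (u 0%N) (v 0%N); first exact: same.
have [u0 v0] : u 0%N = false /\ v 0%N.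
  by move: neq (lex_le_head uv); case: (u 0%N); case: (v 0%N) => // _ /(_ isT).
have rl := realized_lower q f0 f1 (crit_range hT).
have ru' := realized_upper q f0 f1 (crit_range hT).
have H1 : J * (gaps n.+1 (lo q) - gaps n.+1 u) <= coding a (lo q) - coding a u.
  apply: same => //; first exact: realized_le_alpha.
  by rewrite u0 /lower_itinerary /= ltxx.
have H2 : J * (gaps n.+1 v - gaps n.+1 (up q)) <= coding a v - coding a (up q).
  apply: same => //; first exact: realized_ge_beta.
  by rewrite v0 /upper_itinerary /= lexx.
by move: H2; rewrite gaps_crit; move: H1; rewrite /J; lra.
Qed.

Let gaps_ones_ge n : (forall k, 1 <= (num_words k)%:R * a^-1 ^+ k) ->
  (a - 1) *+ n - 1 <= gaps n (fun=> true).
Proof.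
(* Summation by parts: after the subtraction each increment is exactly
   [(a - 1) * num_words n.+1 * a^-1 ^+ n.+1], hence at least [a - 1]. The start is -1, as there is
   one empty word. *)
move=> H; suff : (a - 1) *+ n - 1 <= gaps n (fun=> true) - (num_words n)%:R * a^-1 ^+ n.
  by move=> /le_trans; apply; rewrite lerBlDr lerDl (le_trans _ (H n)).
elim: n => [|n IH].
  by rewrite /gaps big_geq// expr0 -(rank_words hT) rank0 mulr0n mulr1.
rewrite {1}/gaps big_nat_recr//= -/(gaps n _).
have -> k : (rank k (fun=> true))%:R = (num_words k)%:R - 1 :> R.
  by rewrite -(rank_words hT) -natr1 addrK.
have -> k : (rank k (fun=> true))%:R = (num_words k)%:R - 1 :> R.
  by rewrite -(rank_words hT) -natr1 addrK.
have za : a^-1 * a = 1 by rewrite mulVf// gt_eqF.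
have : a - 1 <= (a - 1) * ((num_words n.+1)%:R * a^-1 ^+ n.+1).
  by rewrite ler_peMr ?subr_ge0 ?(ltW a1).
have -> : (a - 1) * ((num_words n.+1)%:R * a^-1 ^+ n.+1) =
    (num_words n.+1)%:R * a^-1 ^+ n - (num_words n.+1)%:R * a^-1 ^+ n.+1.
  rewrite mulrBl mul1r; congr (_ - _).
  by rewrite exprS mulrCA [a * _]mulrA mulfV ?mul1r// gt_eqF.
by rewrite mulrSr; lra.
Qed.

Lemma separates_entropy p : separates p ->
  coding a (lo q) < coding a (up q) -> expR (lorenz_entropy q f0 f1) < a.
Proof.
move=> sp; rewrite -subr_gt0 => J0; rewrite ltNge; apply/negP => ah.
have H k : 1 <= (num_words k)%:R * a^-1 ^+ k.
  rewrite exprVn ler_pdivlMr ?exprn_gt0// mul1r; apply: le_trans (num_words_ge hT k).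
  by rewrite lerXn2r// nnegrE ltW// expR_gt0.
have I0 : 0 <= (0 : R) <= 1 by rewrite lexx ler01.
have I1 : 0 <= (1 : R) <= 1 by rewrite lexx ler01.
have r0 := realized_upper q f0 f1 I0; have r1 := realized_upper q f0 f1 I1.
rewrite (upper_zero hT) in r0; rewrite (upper_one hT) in r1.
have le01 : lex_le (fun=> false) (fun=> true) by move=> n; rewrite code_zeros.
set J := coding a (up q) - coding a (lo q) in J0.
(* The gaps fit into [[0, 1]], so their weighted count is at most [J^-1]; this [n] makes the lower
   bound [(a - 1) * n - 1] exceed that. *)
pose n := Num.bound ((J^-1 + 1) / (a - 1)).
have := gaps_le n sp r0 r1 le01; rewrite (coding_zeros a1) (coding_ones a1) subr0 -/J.
have -> : gaps n (fun=> false) = 0.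
  by rewrite /gaps big1// => k _; rewrite !rank_zeros subrr mulr0.
rewrite subr0 mulrC -ler_pdivlMr// mul1r => /(le_trans (gaps_ones_ge n H)).
rewrite lerBlDr -mulr_natl -ler_pdivlMr ?subr_gt0//.
have : (J^-1 + 1) / (a - 1) < n%:R 
  by rewrite archi_boundP// divr_ge0 ?subr_ge0 ?(ltW a1)// addr_ge0// invr_ge0 ltW.
by move=> /lt_le_trans H' /H'; rewrite ltxx.
Qed.

End SeparatingPoint.

(** * Comparison of the Lorenz system with the uniform maps *)

Section Comparison.
Context {R : realType}.
Variables (q : R) (f0 f1 : R -> R) (a : R).
Hypothesis hT : is_lorenz q f0 f1.
Hypothesis a12 : 1 < a < 2.

Local Notation up := (upper_itinerary q f0 f1).
Local Notation lo := (lower_itinerary q f0 f1).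
Local Notation realized := (realized q f0 f1).
Local Notation pint := (param_interval a (lo q) (up q)).

Let a1 : 1 < a. Proof. by case/andP: a12. Qed.
Let z0 : 0 < a^-1. Proof. by rewrite invr_gt0 (lt_trans _ a1). Qed.

Lemma param_intervalP p : pint p ->
  [/\ coding a (lo q) < p, p < coding a (up q) & 1 - a^-1 < p < a^-1].
Proof. by rewrite /param_interval /= !in_itv /= => -[/andP[-> ->] ->]. Qed.

(** Two open intervals meet when each left end lies below each right end. The bound [a < 2] gives
    [1 - a^-1 < a^-1], and the conditions on [f0 q] and [f1 q] give the two mixed inequalities. *)
Lemma param_interval_nonempty : f0 q < 1 -> 0 < f1 q ->
  coding a (lo q) < coding a (up q) -> pint !=set0.
Proof.
move=> f0q f1q ab.
have z12 : 1 - a^-1 < a^-1.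
  have /andP[_ a2] := a12; have : a^-1 * a < a^-1 * 2 by rewrite ltr_pM2l.
  by rewrite mulVf ?gt_eqF ?(lt_trans _ a1)//; lra.
have bz : 1 - a^-1 < coding a (up q).
  have [k Hk] := beta_shift_has_one hT f1q.
  rewrite coding_shift// {1}/upper_itinerary /= lexx mulr1 ltrDl mulr_gt0//.
  exact: coding_gt0 Hk.
have az : coding a (lo q) < a^-1.
  have [k Hk] := alpha_shift_has_zero hT f0q.
  rewrite coding_shift// {1}/lower_itinerary /= ltxx mulr0 add0r gtr_pMr//.
  exact: coding_lt1 Hk.
pose l := Num.max (coding a (lo q)) (1 - a^-1).
pose r := Num.min (coding a (up q)) a^-1.
have lr : l < r by rewrite /l /r gt_max !lt_min ab az bz z12.
have [] := midf_lt lr; set p := (l + r) / 2; rewrite gt_max lt_min => /andP[p1 p2] /andP[p3 p4].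
by exists p; split; rewrite /= in_itv /= ?p1 ?p2 ?p3 ?p4.
Qed.

(** No realized word has its coding strictly between those of [lo q] and [up q], so strict and weak
    comparison with [p] agree. *)
Lemma unif_itinerary_coding p w : separates q f0 f1 a (coding a (lo q)) ->
  separates q f0 f1 a (coding a (up q)) ->
  coding a (lo q) < p < coding a (up q) -> realized w ->
  unif_lower_itinerary a p (coding a w) = w /\
  unif_upper_itinerary a p (coding a w) = w.
Proof.
move=> sa sb /andP[pa pb] rw.
have H k : iter k shift w 0%N = (p < coding a (iter k shift w)) /\
    iter k shift w 0%N = (p <= coding a (iter k shift w)).
  have rk : realized (iter k shift w) by elim: k => //= k; apply: realized_shift.
  move: (sa _ rk) (sb _ rk); case: (iter k shift w 0%N) => H1 H2.
    by rewrite !(lt_le_trans pb H2) ltW// (lt_le_trans pb H2).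
  by rewrite [p < _]ltNge [p <= _]leNgt (le_lt_trans H1 pa) ltW// (le_lt_trans H1 pa).
by split; [apply: unif_lower_coding|apply: unif_upper_coding] => // k; case: (H k).
Qed.

Lemma small_entropy_separates : expR (lorenz_entropy q f0 f1) < a ->
  [/\ coding a (lo q) < coding a (up q), separates q f0 f1 a (coding a (lo q)) &
      separates q f0 f1 a (coding a (up q))].
Proof.
move=> ha; have ab := coding_crit_lt hT a1 ha.
have ra := realized_lower q f0 f1 (crit_range hT).
have rb := realized_upper q f0 f1 (crit_range hT).
suff H w : realized w ->
    if w 0%N then coding a (up q) <= coding a w else coding a w <= coding a (lo q).
  split => // w /H; case: (w 0%N) => //; first exact/le_trans/ltW.
  by move=> /le_trans; apply; exact: ltW.
move=> rw; case w0 : (w 0%N); apply: (coding_homo hT a1 ha) => //.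
  exact: realized_ge_beta.
exact: realized_le_alpha.
Qed.

(** [lo q] is the uniform lower itinerary of its own coding, which is below [p], so monotonicity
    applies; equality would force that coding to be [p]. The argument for [up q] is symmetric. *)
Lemma small_entropy_crit p : expR (lorenz_entropy q f0 f1) < a -> pint p ->
  [/\ lex_lt (lo q) (unif_lower_itinerary a p p),
      lex_lt (unif_lower_itinerary a p p) (unif_upper_itinerary a p p) &
      lex_lt (unif_upper_itinerary a p p) (up q)].
Proof.
move=> ha /param_intervalP[pa pb hp]; have [ab sa sb] := small_entropy_separates ha.
have hU := unif_lorenz a12 hp; have /andP[p0 p1] := crit_range hU.
have pab : coding a (lo q) < p < coding a (up q) by rewrite pa.
have [La _] := unif_itinerary_coding sa sb pab (realized_lower q f0 f1 (crit_range hT)).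
have [_ Ub] := unif_itinerary_coding sa sb pab (realized_upper q f0 f1 (crit_range hT)).
have pI := crit_range hU.
split.
- apply: lex_le_neq.
    by rewrite -La; apply: (lex_le_lower hU); rewrite ?coding_ge0// ltW.
  move=> E; move: pa; rewrite E (coding_unif a12 hp pI) ?ltxx//; by right.
- by exists 0%N; rewrite /unif_lower_itinerary /lower_itinerary /=
    /unif_upper_itinerary /upper_itinerary /= ltxx lexx.
- apply: lex_le_neq.
    by rewrite -Ub; apply: (lex_le_upper hU); rewrite ?coding_le1// ltW.
  move=> E; move: pb; rewrite -E (coding_unif a12 hp pI) ?ltxx//; by left.
Qed.

Lemma small_entropy_address p : expR (lorenz_entropy q f0 f1) < a -> pint p ->
  lower_address q f0 f1 `<` unif_lower_address a p /\
  upper_address q f0 f1 `<` unif_upper_address a p.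
Proof.
move=> ha /param_intervalP[pa pb hp]; have [ab sa sb] := small_entropy_separates ha.
have hU := unif_lorenz a12 hp; have pI := crit_range hU.
have pab : coding a (lo q) < p < coding a (up q) by rewrite pa.
have mem (x : R) : (x \in `[0, 1]) = (0 <= x <= 1) :> bool by rewrite in_itv.
have cI w : 0 <= coding a w <= 1 by rewrite coding_ge0 ?coding_le1.
split; split.
- move=> _ [x /= + <-]; rewrite mem => xI.
  have [E _] := unif_itinerary_coding sa sb pab (realized_lower q f0 f1 xI).
  by exists (coding a (lo x)) => //; rewrite /= mem.
(* The inclusion is proper because the itinerary of [p] has coding [p], which lies in the gap left
   by realized words. *)
- move=> /(_ (unif_lower_itinerary a p p)) [|x]; first by exists p => //=; rewrite mem.
  rewrite /= mem => xI E; have := sa _ (realized_lower q f0 f1 xI).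
  rewrite E (coding_unif a12 hp pI (or_intror erefl)).
  by rewrite /unif_lower_itinerary /lower_itinerary /= ltxx leNgt pa.
- move=> _ [x /= + <-]; rewrite mem => xI.
  have [_ E] := unif_itinerary_coding sa sb pab (realized_upper q f0 f1 xI).
  by exists (coding a (up x)) => //; rewrite /= mem.
- move=> /(_ (unif_upper_itinerary a p p)) [|x]; first by exists p => //=; rewrite mem.
  rewrite /= mem => xI E; have := sb _ (realized_upper q f0 f1 xI).
  rewrite E (coding_unif a12 hp pI (or_introl erefl)).
  by rewrite /unif_upper_itinerary /upper_itinerary /= lexx leNgt pb.
Qed.

(** Each realized [w] is a uniform itinerary of some [y], so [coding a w = y] and the first symbol
    tells the side of [p]. *)
Lemma address_separates p : 1 - a^-1 < p < a^-1 ->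
  lower_address q f0 f1 `<=` unif_lower_address a p ->
  upper_address q f0 f1 `<=` unif_upper_address a p -> separates q f0 f1 a p.
Proof.
move=> hp Hl Hu w [x xI xw].
have H y : 0 <= y <= 1 -> itinerary_of p (unif0 a) (unif1 a) y w ->
    if w 0%N then p <= coding a w else coding a w <= p.
  move=> yI yw; rewrite (coding_unif a12 hp yI yw).
  case w0 : (w 0%N); first by case: (itinerary_shift1 yI yw w0).
  by case: (itinerary_shift0 yI yw w0).
case: xw => Ew.
  have [|y yI yw] := Hu w; first by exists x => //; rewrite /= in_itv.
  by apply: (H y); [move: yI; rewrite /= in_itv|left].
have [|y yI yw] := Hl w; first by exists x => //; rewrite /= in_itv.
by apply: (H y); [move: yI; rewrite /= in_itv|right].
Qed.

(* If the first symbols of w and of the itinerary of x agree, both sides are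
   contracted by the inverse branch; if they differ, then p separates w from x,
   and x can be replaced by p, whose itinerary is still comparable with w. *)
Lemma crit_separates p : 1 - a^-1 < p < a^-1 ->
  lex_le (lo q) (unif_lower_itinerary a p p) ->
  lex_le (unif_upper_itinerary a p p) (up q) -> separates q f0 f1 a p.
Proof.
move=> hp Ha Hb; have hU := unif_lorenz a12 hp; have pI := crit_range hU.
pose mlo := lower_itinerary p (unif0 a) (unif1 a).
pose mup := upper_itinerary p (unif0 a) (unif1 a).
have shlo y : shift (mlo y) = mlo (lower_map p (unif0 a) (unif1 a) y).
  exact: shift_lower.
have shup y : shift (mup y) = mup (upper_map p (unif0 a) (unif1 a) y).
  exact: shift_upper.
have zn n : 0 <= a^-1 ^+ n by rewrite exprn_ge0 // ltW.
have lowE x : 0 <= x <= 1 -> coding a (mlo x) = x.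
  by move=> xI; apply: (coding_unif a12 hp xI); right.
have upE x : 0 <= x <= 1 -> coding a (mup x) = x.
  by move=> xI; apply: (coding_unif a12 hp xI); left.
have lower n w x : realized w -> 0 <= x <= 1 -> lex_le w (mlo x) ->
    coding a w - x <= a^-1 ^+ n.
  elim: n w x => [|n IH] w x rw xI wx.
    by have := coding_le1 a1 w; case/andP: xI; rewrite expr0; lra.
  have same y : 0 <= y <= 1 -> lex_le w (mlo y) -> w 0%N = mlo y 0%N ->
      coding a w - y <= a^-1 ^+ n.+1.
    move=> yI wy E; have := coding_shift a1 (mlo y); rewrite lowE// -E.
    rewrite shlo lowE; last exact: lower_map_range.
    have := coding_shift a1 w.
    have := IH _ _ (realized_shift hT rw) (lower_map_range hU yI).
    rewrite -shlo => /(_ (lex_le_shift wy E)).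
    by move=> /(ler_wpM2l (ltW z0)); rewrite exprS; lra.
  have [E|neq] := eqVneq (w 0%N) (mlo x 0%N); first exact: same.
  have [w0 x0] : w 0%N = false /\ mlo x 0%N.
    by move: neq (lex_le_head wx); case: (w 0%N); case: (mlo x 0%N) => // _ /(_ isT).
  apply: le_trans (same p _ _ _) => //.
  - by rewrite lerD2l lerN2; move: x0; rewrite /mlo /lower_itinerary /=; exact: ltW.
  - by apply: lex_le_trans Ha; exact: (realized_le_alpha hT).
  - by rewrite w0 /mlo /lower_itinerary /= ltxx.
have upper n w x : realized w -> 0 <= x <= 1 -> lex_le (mup x) w ->
    x - coding a w <= a^-1 ^+ n.
  elim: n w x => [|n IH] w x rw xI wx.
    by have := coding_ge0 a1 w; case/andP: xI; rewrite expr0; lra.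
  have same y : 0 <= y <= 1 -> lex_le (mup y) w -> mup y 0%N = w 0%N ->
      y - coding a w <= a^-1 ^+ n.+1.
    move=> yI wy E; have := coding_shift a1 (mup y); rewrite upE// E.
    rewrite shup upE; last exact: upper_map_range.
    have := coding_shift a1 w.
    have := IH _ _ (realized_shift hT rw) (upper_map_range hU yI).
    rewrite -shup => /(_ (lex_le_shift wy E)).
    by move=> /(ler_wpM2l (ltW z0)); rewrite exprS; lra.
  have [E|neq] := eqVneq (mup x 0%N) (w 0%N); first exact: same.
  have [w0 x0] : w 0%N /\ mup x 0%N = false.
    by move: neq (lex_le_head wx); case: (w 0%N); case: (mup x 0%N) => // _ /(_ isT).
  apply: le_trans (same p _ _ _) => //.
  - rewrite lerD2r; move: x0; rewrite /mup /upper_itinerary /= => /negbT.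
    by rewrite -ltNge; exact: ltW.
  - by apply: lex_le_trans Hb _; exact: (realized_ge_beta hT).
  - by rewrite w0 /mup /upper_itinerary /= lexx.
move=> w rw; case w0 : (w 0%N); rewrite -subr_le0; apply: (le_expr_le0 a1) => n.
  by apply: upper => //; apply: lex_le_trans Hb _; exact: (realized_ge_beta hT).
by apply: lower => //; apply: lex_le_trans Ha; exact: (realized_le_alpha hT).
Qed.

End Comparison.

Theorem theorem1p5 (R : realType) (q : R) (f0 f1 : R -> R)
    (hT : is_lorenz q f0 f1)
    (hlower : lower_map q f0 f1 q <> 1)
    (hupper : upper_map q f0 f1 q <> 0)
    (alpha beta : nat -> bool)
    (halpha : alpha = lower_itinerary q f0 f1 q)
    (hbeta : beta = upper_itinerary q f0 f1 q)
    (a : R) :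
  [<-> expR (lorenz_entropy q f0 f1) < a < 2;
       [/\ 1 < a < 2,
           param_interval a alpha beta !=set0 &
           forall p, param_interval a alpha beta p ->
             [/\ lex_lt alpha (unif_lower_itinerary a p p),
                 lex_lt (unif_lower_itinerary a p p)
                        (unif_upper_itinerary a p p) &
                 lex_lt (unif_upper_itinerary a p p) beta]];
       [/\ 1 < a < 2,
           param_interval a alpha beta !=set0 &
           forall p, param_interval a alpha beta p ->
             lower_address q f0 f1 `<` unif_lower_address a p /\
             upper_address q f0 f1 `<` unif_upper_address a p]].
Proof.
subst alpha beta.
have [q0 q1 f0q f1q _] := lorenz_bounds hT.
have f0q1 : f0 q < 1.
  rewrite lt_neqAle f0q andbT; apply/eqP => E.
  by apply: hlower; rewrite /lower_map lexx.
have f1q0 : 0 < f1 q.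
  rewrite lt_neqAle f1q andbT; apply/eqP => E.
  by apply: hupper; rewrite /upper_map ltxx.
have entropyP p : 1 < a < 2 ->
    param_interval a (lower_itinerary q f0 f1 q) (upper_itinerary q f0 f1 q) p ->
    separates q f0 f1 a p -> expR (lorenz_entropy q f0 f1) < a.
  move=> /andP[a1 _] /param_intervalP[pa pb _] sp.
  exact: (separates_entropy hT a1 sp (lt_trans pa pb)).
tfae.
- move=> /andP[ha a2].
  have a12 : 1 < a < 2.
    (* [1 < a] comes from the entropy being nonnegative. *)
    by rewrite a2 andbT (le_lt_trans _ ha)// -expR0 ler_expR; case: (entropy_spec hT).
  have [ab _ _] := small_entropy_separates hT a12 ha.
  split => // [|p]; first exact: param_interval_nonempty.
  exact: small_entropy_crit.
- move=> [a12 [p pP] H]; split => //; first by exists p.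
  (* A single [p] recovers the entropy bound, which then gives the inclusions at every [p']. *)
  have ha : expR (lorenz_entropy q f0 f1) < a.
    have [/lex_ltW Ha _ /lex_ltW Hb] := H p pP; apply: (entropyP p) => //.
    have [_ _ hp] := param_intervalP pP; exact: (crit_separates hT a12 hp).
  by move=> p'; exact: small_entropy_address.
- move=> [a12 [p pP] H]; have [[Hl _] [Hu _]] := H p pP.
  have [_ _ hp] := param_intervalP pP; have /andP[_ ->] := a12; rewrite andbT.
  by apply: (entropyP p) => //; exact: (address_separates a12 hp).
Qed.
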